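(* Let $k,M\in\mathbb{N}$, $\hat m=2^kM$, let $\Psi(t)=[\psi_1(t),\ldots,\psi_{\hat m}(t)]^T$ be the Chebyshev wavelets vector on $[0,1]$, and let $q\in\mathbb{N}$ and $\vartheta(x,t)$ be a positive function defined for $(x,t)\in[0,1]\times[0,1]$ with $q-1<\vartheta(x,t)\le q$. Then the variable-order fractional derivative of order $\vartheta(x,t)$ in the Caputo sense (with respect to $t$, taken entrywise) of $\Psi(t)$ is given by $${}^{c}_{0}D_t^{\vartheta(x,t)}\Psi(t)=\mathbf{Q}_t^{\vartheta(x,t)}\Psi(t)=\left(\mathbf{P}^{-1}\mathbf{T}_t^{\vartheta(x,t)}\mathbf{P}\right)\Psi(t),$$ where $\mathbf{P}$ is the $\hat m\times\hat m$ coefficient matrix with $\Phi(t)=\mathbf{P}\Psi(t)$, $\Phi(t)$ being the vector of piecewise monomials $\phi_{nm}$, and $\mathbf{T}_t^{\vartheta(x,t)}$ is the $\hat m\times\hat m$ block-diagonal matrix with $2^k$ diagonal blocks all equal to $\mathbf{G}_t^{\vartheta(x,t)}$ (the operational matrix of variable-order fractional derivative of order $\vartheta(x,t)$ for the piecewise monomials).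
   Context: Chebyshev wavelets: for $n=0,1,\ldots,2^k-1$ and $m=0,1,\ldots,M-1$, $\psi_{nm}(t)=\beta_m2^{k/2}T^*_m(2^kt-n)$ for $t\in\left[\frac{n}{2^k},\frac{n+1}{2^k}\right]$ and $\psi_{nm}(t)=0$ otherwise, where $\beta_0=\sqrt{2/\pi}$, $\beta_m=2/\sqrt{\pi}$ for $m\ge1$, and $T^*_m$ are the shifted Chebyshev polynomials on $[0,1]$: $T^*_0(t)=1$, $T^*_m(t)=m\sum_{i=0}^m(-1)^{m-i}\frac{2^{2i}(m+i-1)!}{(m-i)!(2i)!}t^i$ for $m\ge1$. They are indexed as $\psi_i=\psi_{nm}$ with $i=Mn+m+1$, $i=1,\ldots,\hat m$. Piecewise monomials: for the same $n,m$, $\phi_{nm}(t)=t^m$ for $t\in\left[\frac{n}{2^k},\frac{n+1}{2^k}\right]$ and $\phi_{nm}(t)=0$ otherwise; $\phi_i=\phi_{nm}$ with $i=Mn+m+1$, and $\Phi(t)=[\phi_1(t),\ldots,\phi_{\hat m}(t)]^T$. Matrix $\mathbf{P}=[p_{ij}]$: $p_{ij}=(\phi_i,\psi_j)$, the inner product in $L^2_{w_n}[0,1]$, where $n$ is the first index of $\psi_j=\psi_{nm}$ and the weight is $w_n(t)=\frac{1}{\sqrt{1-(2^{k+1}t-2n-1)^2}}$ for $t\in\left[\frac{n}{2^k},\frac{n+1}{2^k}\right]$ and $w_n(t)=0$ otherwise. One has $\Phi(t)=\mathbf{P}\Psi(t)$. Matrix $\mathbf{G}_t^{\vartheta(x,t)}$: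 the $M\times M$ diagonal matrix whose $(m+1,m+1)$ entry, $m=0,\ldots,M-1$, is $t^{-\vartheta(x,t)}\frac{m!}{\Gamma(m-\vartheta(x,t)+1)}$ if $m\ge q$, and $0$ if $m<q$. Caputo variable-order derivative: for $0<\gamma(x,t)\le1$, ${}^{c}_{0}D_t^{\gamma(x,t)}u(x,t)=\frac{1}{\Gamma(1-\gamma(x,t))}\int_0^t(t-s)^{-\gamma(x,t)}\frac{\partial u(x,s)}{\partial s}\,ds$, $t>0$; for $q-1<\vartheta(x,t)\le q$, correspondingly, ${}^{c}_{0}D_t^{\vartheta(x,t)}u(x,t)=\frac{1}{\Gamma(q-\vartheta(x,t))}\int_0^t(t-s)^{q-1-\vartheta(x,t)}\frac{\partial^q u(x,s)}{\partial s^q}\,ds$, $t>0$ (with the usual convention that it is $\partial^q u/\partial t^q$ where $\vartheta(x,t)=q$). It satisfies ${}^{c}_{0}D_t^{\vartheta(x,t)}t^m=\frac{\Gamma(m+1)}{\Gamma(m-\vartheta(x,t)+1)}t^{m-\vartheta(x,t)}$ for integers $m\ge q$, and $0$ for integers $0\le m<q$.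
   Formalization: The Caputo derivative is taken piece by piece: on each dyadic interval it is the Caputo derivative, from base point 0, of the polynomial giving the wavelet there; with the Caputo integral of the wavelet itself the claim is false for k ≥ 1 (e.g. k=1, M=2, q=1, order 1/2, t=3/4). *)

(* Defs.v *)
From mathcomp Require Import all_boot all_order all_algebra.
From mathcomp Require Import mxtens.
From mathcomp Require Import all_classical all_reals all_analysis.

Set Implicit Arguments.
Unset Strict Implicit.
Unset Printing Implicit Defensive.

Import Order.TTheory GRing.Theory Num.Theory.
Import numFieldNormedType.Exports.

Local Open Scope classical_set_scope.
Local Open Scope ring_scope.

Section SpecialFunctions.
Context {R : realType}.

(* Euler's integral; meaningful for 0 < a, and only used there. *)
Definition Gamma (a : R) : R :=
  \int[@lebesgue_measure R]_(s in `]0, +oo[) (s `^ (a - 1) * expR (- s)).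

(* Caputo derivative of order th, q - 1 < th <= q, with base point 0, of u at
   t > 0.  The order is frozen at its value th = vartheta(x, t). *)
Definition caputo (q : nat) (th : R) (u : R -> R) (t : R) : R :=
  if th == q%:R then derive1n q u t
  else (Gamma (q%:R - th))^-1 *
       \int[@lebesgue_measure R]_(s in `[0, t])
         ((t - s) `^ (q%:R - 1 - th) * derive1n q u s).

Definition shifted_chebyshev (m : nat) (t : R) : R :=
  if m is 0 then 1
  else m%:R * \sum_(i < m.+1)
         (-1) ^+ (m - i) * (2 ^ (2 * i) * (m + i - 1)`!)%:R
         / ((m - i)`! * (2 * i)`!)%:R * t ^+ i.

End SpecialFunctions.

Section Pieces.
Context {R : realType}.
Variable k : nat.

(* The pieces are closed, so neighbouring ones share an endpoint. *)
Definition dyadic (n : nat) : set R :=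
  `[n%:R / 2 ^+ k, n.+1%:R / 2 ^+ k].

Definition piece (n : nat) (g : R -> R) (t : R) : R :=
  if t \in dyadic n then g t else 0.

Definition cheb_beta (m : nat) : R :=
  if m is 0 then Num.sqrt (2 / pi) else 2 / Num.sqrt pi.

Definition psi (n m : nat) : R -> R :=
  piece n (fun t => cheb_beta m * 2 `^ (k%:R / 2)
                    * shifted_chebyshev m (2 ^+ k * t - n%:R)).

Definition phi (n m : nat) : R -> R := piece n (fun t => t ^+ m).

Definition weight (n : nat) : R -> R :=
  piece n (fun t =>
    (Num.sqrt (1 - (2 ^+ k.+1 * t - (2 * n)%:R - 1) ^+ 2))^-1).

Definition inner (w f g : R -> R) : R :=
  \int[@lebesgue_measure R]_(t in `[0, 1]) (f t * g t * w t).

(* The polynomial which f coincides with inside the n-th piece; endpoints are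
   left out because there f may also carry the value of the neighbouring
   piece. *)
Definition branch (n : nat) (f : R -> R) : {poly R} :=
  xget 0 [set p : {poly R} | forall t : R,
    n%:R / 2 ^+ k < t < n.+1%:R / 2 ^+ k -> f t = p.[t]].

(* Caputo derivative of a piecewise polynomial function, taken piece by piece:
   on the n-th piece it is the Caputo derivative (base point 0) of the
   polynomial expression giving f there.  It is this operator, and not the
   Caputo integral of the globally defined function f, which maps
   piecewise t^m to piecewise m! / Gamma (m - th + 1) t^(m - th): the latter
   has a memory of the earlier pieces. *)
Definition pw_caputo (q : nat) (th : R) (f : R -> R) (t : R) : R :=
  \sum_(n < (2 ^ k)%N) piece n (caputo q th (horner (branch n f))) t.

End Pieces.

Section Matrices.
Context {R : realType}.
Variables k M : nat.

(* The 0-based index i = M n + m stands for the pair (n, m). *)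
Definition idx_n (i : 'I_(2 ^ k * M)) : nat := (mxtens_unindex i).1.
Definition idx_m (i : 'I_(2 ^ k * M)) : nat := (mxtens_unindex i).2.

Definition psi_idx (i : 'I_(2 ^ k * M)) : R -> R := psi k (idx_n i) (idx_m i).
Definition phi_idx (i : 'I_(2 ^ k * M)) : R -> R := phi k (idx_n i) (idx_m i).

Definition Psi (t : R) : 'cV[R]_(2 ^ k * M) := \col_i psi_idx i t.
Definition Phi (t : R) : 'cV[R]_(2 ^ k * M) := \col_i phi_idx i t.

Definition Pmx : 'M[R]_(2 ^ k * M) :=
  \matrix_(i, j) inner (weight k (idx_n j)) (phi_idx i) (psi_idx j).

Definition Gmx (q : nat) (th t : R) : 'M[R]_M :=
  diag_mx (\row_(m < M)
    (if (q <= m)%N then t `^ (- th) * (m`!%:R / Gamma (m%:R - th + 1)) else 0)).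

(* The Kronecker product with the identity is diag(G, ..., G), 2 ^ k blocks. *)
Definition Tmx (q : nat) (th t : R) : 'M[R]_(2 ^ k * M) :=
  (1%:M : 'M[R]_(2 ^ k)) *t Gmx q th t.

Definition pw_caputo_vec (q : nat) (th : R) (V : R -> 'cV[R]_(2 ^ k * M))
    (t : R) : 'cV[R]_(2 ^ k * M) :=
  \col_i pw_caputo k q th (fun s => V s i 0) t.

End Matrices.

(* Main.v *)
(* Write psi_i as a combination sum_l B_il phi_l of the piecewise monomials of its
   piece; this holds at every point, shared endpoints included.  The substitution
   2^(k+1) t - 2n - 1 = cos x turns T*_m (2^k t - n) into cos (m x) and the weight
   into dx, so the wavelets are orthonormal, which says exactly that B P = 1.
   Hence P is invertible with inverse B, Phi = P Psi, and P^-1 T P Psi = B T Phi.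
   Since the Caputo derivative of a polynomial is linear in its coefficients, the
   derivative formula reduces to that of t^m, i.e. to the Euler beta integral of
   s^j (t - s)^(a - 1) and to Gamma (a + 1) = a Gamma a.  These
   integrals are improper, hence computed by the fundamental theorem of calculus
   along an exhaustion by compact intervals. *)

Require Import Defs.
From mathcomp Require Import all_boot all_order all_algebra.
From mathcomp Require Import mxtens.
From mathcomp Require Import all_classical all_reals all_analysis measurable_realfun.
From mathcomp Require Import ring lra zify.

Set Implicit Arguments.
Unset Strict Implicit.
Unset Printing Implicit Defensive.

Import Order.TTheory GRing.Theory Num.Theory.
Import numFieldNormedType.Exports.
Local Open Scope classical_set_scope.
Local Open Scope ring_scope.

(** * Improper integrals *)

(** Monotone convergence along an exhaustion serves nonnegative integrands only, whereas the
    derivatives of s^a e^(-s), of s^(j+1) (t - s)^a and of the sine of a multiple of the angle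
    change sign. Each integrand is therefore paired with a nonnegative majorant that has an
    elementary primitive as well: the derivative of (s / (1 + s))^a for Gamma, a multiple of (t -
    s)^(a - 1) for the beta integral, the weight itself for the cosines. No change of variables is
    carried out: the substitution by cos x is replaced by primitives written in terms of the angle.
    The polynomials T*_m are given by their coefficients alone, so cos (m x) has to come from the
    three-term recurrence, checked on these coefficients. The powers t^m are never expanded in
    wavelets. Entry (i, j) of B P is the inner product of psi_i with psi_j, and for square matrices
    B P = 1 yields P B = 1, which turns Psi = B Phi into Phi = P Psi. *)

Section ImproperFTC.
Context {R : realType}.
Notation mu := (@lebesgue_measure R).
Variables (a b : R^nat) (D : set R).
Hypothesis ab : forall n, a n < b n.
Hypothesis nondecr_ab : nondecreasing_seq (fun n => `[a n, b n]%classic : set R).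
Hypothesis bigcup_ab : \bigcup_n `[a n, b n]%classic = D.

Lemma exhaust_subset n : `[a n, b n]%classic `<=` D.
Proof. by move=> x xab; rewrite -bigcup_ab; exists n. Qed.

Lemma exhaust_measurable : measurable D.
Proof. by rewrite -bigcup_ab; exact: bigcup_measurable. Qed.

Lemma exhaust_measurable_fun (f : R -> R) :
  (forall x, D x -> {for x, continuous f}) -> measurable_fun D f.
Proof.
move=> cf; rewrite -bigcup_ab; apply/measurable_fun_bigcup => // n.
apply: subspace_continuous_measurable_fun => //.
apply: continuous_in_subspaceT => x /set_mem xab; apply: cf.
exact: exhaust_subset xab.
Qed.

(** Since [f] is nonnegative, its integrals over the compact intervals converge to the one over [D]
    by monotone convergence, and the fundamental theorem evaluates each of them. The integral is
    extended-real, so finiteness is part of the conclusion. *)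
Lemma ge0_improper_FTC (f F : R -> R) (l : R) :
  (forall x, D x -> 0 <= f x) ->
  (forall x, D x -> {for x, continuous f}) ->
  (forall x, D x -> is_derive x 1 F (f x)) ->
  F (b n) - F (a n) @[n --> \oo] --> l ->
  (\int[mu]_(x in D) (f x)%:E = l%:E)%E.
Proof.
move=> f0 cf dF Fl.
have mf := exhaust_measurable_fun cf.
have step n : (\int[mu]_(x in `[a n, b n]) (f x)%:E = (F (b n) - F (a n))%:E)%E.
  have cF x : D x -> {for x, continuous F}.
    move=> /dF [dFx _]; exact/differentiable_continuous/derivable1_diffP.
  have Da : D (a n) by apply: (@exhaust_subset n); rewrite /= in_itv/= lexx ltW.
  have Db : D (b n) by apply: (@exhaust_subset n); rewrite /= in_itv/= lexx ltW.
  have Do x : x \in `]a n, b n[ -> D x.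
    move=> xab; apply: (@exhaust_subset n).
    exact: subset_itv_oo_cc xab.
  rewrite EFinB; apply: continuous_FTC2 => //.
  - apply: continuous_in_subspaceT => x /set_mem xab; apply: cf.
    exact: exhaust_subset xab.
  - split.
    + by move=> x /Do /dF [].
    + by apply: cvg_at_right_filter; exact: cF.
    + by apply: cvg_at_left_filter; exact: cF.
  - by move=> x /Do /dF [_]; rewrite derive1E.
have cvgD : (\int[mu]_(x in `[a n, b n]) (f x)%:E @[n --> \oo] -->
    \int[mu]_(x in D) (f x)%:E)%E.
  rewrite -bigcup_ab; apply: ge0_nondecreasing_set_cvg_integral => //.
  - move=> i; apply/measurable_EFinP; apply: measurable_funS mf => //.
      exact: exhaust_measurable.
    exact: exhaust_subset.
  - by move=> i x xab; rewrite lee_fin; apply: f0; exact: exhaust_subset xab.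
have cvgl : ((F (b n) - F (a n))%:E @[n --> \oo] --> l%:E)%E.
  by apply: cvg_EFin => //; exact: nearW.
by rewrite (funext step) in cvgD; exact: cvg_unique cvgD cvgl.
Qed.

(* [f + g] and [g] are nonnegative, so that the previous lemma applies to both. *)
Lemma improper_FTC (f g F G : R -> R) (lF lG : R) :
  (forall x, D x -> `|f x| <= g x) ->
  (forall x, D x -> {for x, continuous f}) ->
  (forall x, D x -> {for x, continuous g}) ->
  (forall x, D x -> is_derive x 1 F (f x)) ->
  (forall x, D x -> is_derive x 1 G (g x)) ->
  F (b n) - F (a n) @[n --> \oo] --> lF ->
  G (b n) - G (a n) @[n --> \oo] --> lG ->
  mu.-integrable D (EFin \o f) /\ \int[mu]_(x in D) f x = lF.
Proof.
move=> fg cf cg dF dG FlF GlG.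
have mD := exhaust_measurable.
have g0 x : D x -> 0 <= g x by move=> /fg; exact: le_trans.
have intE (h : R -> R) (l : R) : (forall x, D x -> 0 <= h x) ->
    (forall x, D x -> {for x, continuous h}) ->
    (\int[mu]_(x in D) (h x)%:E = l%:E)%E ->
    mu.-integrable D (EFin \o h).
  move=> h0 ch hl; apply/integrableP; split.
    by apply/measurable_EFinP; exact: exhaust_measurable_fun.
  suff -> : (\int[mu]_(x in D) `|(EFin \o h) x| = l%:E)%E by rewrite ltry.
  rewrite -hl; apply: eq_integral => x /set_mem Dx.
  by rewrite /= ger0_norm// h0.
have gE := ge0_improper_FTC g0 cg dG GlG.
have fg0 x : D x -> 0 <= f x + g x.
  by move=> /fg; rewrite ler_norml => /andP[+ _]; rewrite -subr_ge0 opprK.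
have cfg x : D x -> {for x, continuous (fun x => f x + g x)}.
  by move=> Dx; apply: cvgD; [exact: cf|exact: cg].
have dFG x : D x -> is_derive x 1 (F + G) (f x + g x).
  by move=> Dx; apply: is_deriveD; [exact: dF|exact: dG].
have lFG : (F + G) (b n) - (F + G) (a n) @[n --> \oo] --> lF + lG.
  rewrite (_ : (fun _ => _) =
    (fun n => (F (b n) - F (a n)) + (G (b n) - G (a n)))); last first.
    by apply/funext => n /=; rewrite !fctE addrACA opprD.
  exact: cvgD.
have fgE := ge0_improper_FTC fg0 cfg dFG lFG.
have ig := intE _ _ g0 cg gE.
have ifg := intE _ _ fg0 cfg fgE.
have fE : f = (fun x => f x + g x - g x) by apply/funext => x; rewrite addrK.
have fEE : EFin \o f = ((EFin \o (fun x => (f x + g x)%R)) \- (EFin \o g))%E.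
  by apply/funext => x /=; rewrite -EFinB addrK.
split; first by rewrite fEE; exact: integrableB.
by rewrite fE RintegralB// /Rintegral fgE gE /= addrK.
Qed.

End ImproperFTC.

Lemma is_derive_continuous {R : realType} (f : R -> R) (x d : R) :
  is_derive x 1 f d -> {for x, continuous f}.
Proof.
by move=> [df _]; exact/differentiable_continuous/derivable1_diffP.
Qed.

Lemma continuous_powR {R : realType} (p x : R) : 0 < x ->
  {for x, continuous (fun u : R => u `^ p)}.
Proof. by move=> x0; exact: is_derive_continuous (is_derive1_powR p x0). Qed.

(** The shifts make the interval nondegenerate from the start: it is [1/2, 1] at n = 0. *)
Lemma exhaust_itv0y (R : realType) :
  nondecreasing_seq
    (fun n => `[n.+2%:R^-1, n.+1%:R]%classic : set R) /\
  \bigcup_n `[n.+2%:R^-1, n.+1%:R]%classic = `]0, +oo[%classic :> set R.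
Proof.
split.
  apply/nondecreasing_seqP => n; rewrite subsetEset => x /=.
  rewrite !in_itv/= => /andP[ax xb]; apply/andP; split.
    by rewrite (le_trans _ ax)// lef_pV2 ?posrE// ler_nat.
  by rewrite (le_trans xb)// ler_nat.
apply/seteqP; split => x /=.
  by move=> [n _]; rewrite /= !in_itv/= andbT => /andP[+ _]; apply: lt_le_trans.
rewrite in_itv/= andbT => x0.
exists (Num.trunc x + Num.trunc x^-1)%N => //=; rewrite in_itv/=.
have [xi0 x0'] : 0 < x^-1 /\ 0 <= x by rewrite invr_gt0 ltW.
apply/andP; split.
  rewrite -[leRHS]invrK lef_pV2 ?posrE// ltW// (lt_le_trans (truncnS_gt _))//.
  by rewrite ler_nat ltnS; exact: leq_trans (leq_addl _ _) (leqnSn _).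
by rewrite ltW// (lt_le_trans (truncnS_gt _))// ler_nat ltnS leq_addr.
Qed.

Lemma exhaust_itvoo {R : realType} (a b : R^nat) (x y : R) :
  nonincreasing_seq a -> nondecreasing_seq b ->
  (forall n, x < a n) -> (forall n, b n < y) ->
  a @ \oo --> x -> b @ \oo --> y ->
  nondecreasing_seq (fun n => `[a n, b n]%classic : set R) /\
  \bigcup_n `[a n, b n]%classic = `]x, y[%classic.
Proof.
move=> na nb xa yb ax by_; split.
  move=> n m nm; rewrite subsetEset => z /=; rewrite !in_itv/=.
  by move=> /andP[/(le_trans (na _ _ nm)) -> /le_trans]; apply; exact: nb.
apply/seteqP; split => z /=.
  move=> [n _] /=; rewrite !in_itv/= => /andP[az zb].
  by rewrite (lt_le_trans (xa n))//= (le_lt_trans zb).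
rewrite in_itv/= => /andP[xz zy].
have az : \forall n \near \oo, a n <= z by apply: (cvgr_le x).
have bz : \forall n \near \oo, z <= b n by apply: (cvgr_ge y).
near \oo => n; exists n => //=; rewrite in_itv/=.
by apply/andP; split; near: n.
Unshelve. all: by end_near. Qed.

(** * The Gamma function *)

Section Gamma.
Context {R : realType}.
Notation mu := (@lebesgue_measure R).
Implicit Types a s : R.

Definition Gamma_integrand a s := s `^ (a - 1) * expR (- s).

(* The derivative of (s / (1 + s))^a: it dominates the Gamma integrand, up to a
   constant, near 0 and near +oo at the same time. *)
Definition beta_prime_density a s := a * s `^ (a - 1) * (1 + s) `^ (- a - 1).

(** Distribution function of the beta prime law with parameters a and 1. It is kept as a product of
    functions, s^a times (1 + s)^(-a), so that the product and chain rules apply; [beta_prime_cdfE]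
    gives the quotient form. *)
Definition beta_prime_cdf a : R -> R :=
  (fun u : R => u `^ a) * ((fun u : R => u `^ (- a)) \o (cst 1 + id)).

Lemma powRS (x p : R) : 0 < x -> x `^ (p + 1) = x * x `^ p.
Proof.
move=> x0; rewrite powRD; first by rewrite powRr1 ?ltW// mulrC.
by rewrite (gt_eqF x0) implybT.
Qed.

Lemma is_derive_beta_prime a s : 0 < s ->
  is_derive s 1 (beta_prime_cdf a) (beta_prime_density a s).
Proof.
move=> s0; have s1 : 0 < 1 + s by rewrite addr_gt0.
have d1 := is_derive1_powR a s0.
have d2 : is_derive ((cst 1 + id) s) 1 (fun u : R => u `^ (- a))
    (- a * (1 + s) `^ (- a - 1)).
  exact: is_derive1_powR.
have d3 : is_derive s 1 (cst 1 + id) (0 + 1 : R) by exact: is_deriveD.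
apply: is_derive_eq (is_deriveM d1 (is_derive1_comp d2 d3)) _.
rewrite /beta_prime_density /= !fctE /GRing.scale /=.
(* One factor is split off s^a and one off (1 + s)^(-a); with equal powers everywhere the claim
   becomes (1 + s) - s = 1. *)
rewrite -[in s `^ a](subrK 1 a) powRS//.
rewrite -[in X in _ + X](subrK 1 (- a)) powRS//; ring.
Qed.

(* ln x <= x - 1 at x = (1 + s) / p *)
Lemma powR_1Ds_le p s : 0 < p -> 0 < s ->
  (1 + s) `^ p <= expR (p * ln p + 1 - p) * expR s.
Proof.
move=> p0 s0; have s1 : 0 < 1 + s by rewrite addr_gt0.
rewrite /powR gt_eqF// -expRD ler_expR.
have sp : 0 < (1 + s) / p by rewrite divr_gt0.
have -> : 1 + s = p * ((1 + s) / p) by field; rewrite gt_eqF.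
rewrite lnM ?posrE// mulrDr -!addrA lerD2l.
have lnsp : ln ((1 + s) / p) <= (1 + s) / p - 1.
  have := @le_ln1Dx _ ((1 + s) / p - 1).
  by rewrite [1 + (_ - 1)]addrC subrK ltrBrDl subrr; apply.
apply: (@le_trans _ _ (p * ((1 + s) / p - 1))).
  by rewrite ler_pM2l// lnsp.
by rewrite le_eqVlt; apply/orP; left; apply/eqP; field; rewrite gt_eqF.
Qed.

(** The quotient of the integrand by the density is (1 + s)^(a + 1) e^(-s) / a. Its maximum, at s =
    a, is the constant K, that is p^p e^(1 - p) / a with p = a + 1. *)
Lemma Gamma_integrand_le a : 0 < a ->
  exists2 K, 0 <= K & forall s, 0 < s ->
    Gamma_integrand a s <= K * beta_prime_density a s.
Proof.
move=> a0; have a1 : 0 < a + 1 by rewrite addr_gt0.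
exists (expR ((a + 1) * ln (a + 1) + 1 - (a + 1)) / a).
  by rewrite divr_ge0 ?expR_ge0// ltW.
move=> s s0; have s1 : 0 < 1 + s by rewrite addr_gt0.
rewrite /Gamma_integrand /beta_prime_density.
rewrite -!mulrA mulKf ?gt_eqF// mulrCA ler_pM2l ?powR_gt0//.
rewrite -opprD powRN ler_pdivlMr ?powR_gt0//.
by rewrite expRN mulrC ler_pdivrMr ?expR_gt0// powR_1Ds_le.
Qed.

Lemma cvg_invSS : n.+2%:R^-1 @[n --> \oo] --> (0 : R).
Proof.
have := @cvg_harmonic R; rewrite -cvg_shiftS; exact.
Qed.

Lemma beta_prime_cdfE a s : 0 < s ->
  beta_prime_cdf a s = (s / (1 + s)) `^ a.
Proof.
move=> s0; have s1 : 0 < 1 + s by rewrite addr_gt0.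
rewrite /beta_prime_cdf !fctE /= powRM ?invr_ge0 ?ltW//; congr (_ * _).
by rewrite -powR_inv1 ?ltW// -powRrM mulN1r.
Qed.

(** At the two endpoints of the exhaustion s / (1 + s) equals 1 - 1 / (n + 2) and 1 / (n + 3). *)
Lemma beta_prime_cdf_cvg a : 0 < a ->
  beta_prime_cdf a n.+1%:R - beta_prime_cdf a n.+2%:R^-1 @[n --> \oo] --> (1 - 0 : R).
Proof.
move=> a0; apply: cvgB.
  have -> : (fun n => beta_prime_cdf a n.+1%:R) =
    (fun n => (1 - n.+2%:R^-1) `^ a) :> (nat -> R).
    apply/funext => n; rewrite beta_prime_cdfE//; congr (_ `^ _).
    by rewrite -!natr1; field; rewrite !natr1 pnatr_eq0.
  have c1 := @continuous_powR R a 1 ltr01.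
  have h1 : (1 - n.+2%:R^-1 : R) @[n --> \oo] --> (1 : R).
    rewrite -[X in _ --> X]subr0; apply: cvgB; first exact: cvg_cst.
    exact: cvg_invSS.
  have := @continuous_cvg _ _ _ _ _ _ (fun u : R => u `^ a) _ c1 h1.
  by rewrite /= powR1; apply.
have -> : (fun n => beta_prime_cdf a n.+2%:R^-1) =
    (fun n => n.+3%:R^-1 `^ a) :> (nat -> R).
  apply/funext => n; rewrite beta_prime_cdfE ?invr_gt0//; congr (_ `^ _).
  have m0 : 0 < (n.+2%:R : R) by [].
  rewrite -[n.+3%:R]natr1; field.
  by apply/andP; split; apply: lt0r_neq0; have := ler0n R n; lra.
have /cvg_at_rightP/(_ (fun n => n.+3%:R^-1)) := powR_cvg0 a0; apply.
split => //; have := cvg_invSS; rewrite -cvg_shiftS; exact.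
Qed.
Let D0y : set R := `]0, +oo[%classic.

Lemma continuous_Gamma_integrand a s : 0 < s ->
  {for s, continuous (Gamma_integrand a)}.
Proof.
move=> s0; apply: cvgM; first exact: continuous_powR.
by apply: continuous_comp; [exact: opp_continuous|exact: continuous_expR].
Qed.

Lemma continuous_beta_prime_density a s : 0 < s ->
  {for s, continuous (beta_prime_density a)}.
Proof.
move=> s0; apply: cvgM; first by apply: cvgMr; exact: continuous_powR.
suff : {for s, continuous ((fun u : R => u `^ (- a - 1)) \o (fun u => 1 + u))}.
  exact.
apply: continuous_comp.
  by apply: cvgD; [exact: cvg_cst|exact: cvg_id].
by apply: continuous_powR; rewrite addr_gt0.
Qed.

Lemma Gamma_integrand_ge0 a s : 0 <= Gamma_integrand a s.
Proof. by rewrite mulr_ge0 ?powR_ge0 ?expR_ge0. Qed.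

Lemma beta_prime_density_ge0 a s : 0 < a -> 0 <= beta_prime_density a s.
Proof. by move=> a0; rewrite !mulr_ge0 ?powR_ge0 ?(ltW a0). Qed.

Lemma invSS_lt n : n.+2%:R^-1 < n.+1%:R :> R.
Proof.
by rewrite (@lt_le_trans _ _ 1)// ?invf_lt1 ?ltr1n// ler1n.
Qed.

(** The integrand has no elementary primitive, so [improper_FTC] is applied to the beta prime
    density, dominated by itself, and integrability is inherited by comparison. *)
Lemma integrable_Gamma_integrand a : 0 < a ->
  mu.-integrable D0y (EFin \o Gamma_integrand a).
Proof.
move=> a0; have [K K0 GK] := Gamma_integrand_le a0.
have [nab Dab] := exhaust_itv0y R.
have [|||||||ib _] := @improper_FTC R _ _ D0y invSS_lt nab Dab
  (beta_prime_density a) (beta_prime_density a)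
  (beta_prime_cdf a) (beta_prime_cdf a) (1 - 0) (1 - 0).
- by move=> x _; rewrite ger0_norm// beta_prime_density_ge0.
- by move=> x; rewrite /D0y/= in_itv/= andbT; exact: continuous_beta_prime_density.
- by move=> x; rewrite /D0y/= in_itv/= andbT; exact: continuous_beta_prime_density.
- by move=> x; rewrite /D0y/= in_itv/= andbT; exact: is_derive_beta_prime.
- by move=> x; rewrite /D0y/= in_itv/= andbT; exact: is_derive_beta_prime.
- exact: beta_prime_cdf_cvg.
- exact: beta_prime_cdf_cvg.
apply: le_integrable (integrableZl _ K ib) => //; try exact: measurable_itv.
- apply/measurable_EFinP; apply: (exhaust_measurable_fun Dab) => x.
  by rewrite /D0y/= in_itv/= andbT; exact: continuous_Gamma_integrand.
- move=> x; rewrite /D0y/= in_itv/= andbT => x0.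
  have b0 := beta_prime_density_ge0 x a0.
  by rewrite lee_fin !ger0_norm ?Gamma_integrand_ge0 ?(mulr_ge0 K0 b0)// GK.
Qed.

Lemma cvg_expRN_natr : expR (- n.+1%:R) @[n --> \oo] --> (0 : R).
Proof.
apply: (@squeeze_cvgr _ _ _ _ (fun=> 0) (@harmonic R)); last 2 first.
- exact: cvg_cst.
- exact: cvg_harmonic.
apply: nearW => n; rewrite expR_ge0/= expRN lef_pV2 ?posrE ?expR_gt0//.
by apply: le_trans (expR_ge1Dx _); rewrite lerDr.
Qed.

Lemma cvg_expRN_invSS : expR (- n.+2%:R^-1) @[n --> \oo] --> (1 : R).
Proof.
have h1 : (- n.+2%:R^-1 : R) @[n --> \oo] --> (0 : R).
  by rewrite -[X in _ --> X]oppr0; apply: cvgN; exact: cvg_invSS.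
have := @continuous_cvg _ _ _ _ _ _ expR _ (@continuous_expR R 0) h1.
by rewrite expR0; apply.
Qed.

Lemma Gamma1 : Gamma (1 : R) = 1.
Proof.
have [nab Dab] := exhaust_itv0y R.
have cvgF : (- expR (- n.+1%:R)) - (- expR (- n.+2%:R^-1)) @[n --> \oo]
    --> (- 0 + 1 : R).
  under eq_fun do rewrite opprK.
  by apply: cvgD; [apply: cvgN; exact: cvg_expRN_natr|exact: cvg_expRN_invSS].
have dF (x : R) : D0y x ->
    is_derive x 1 (- (expR \o -%R) : R -> R) (Gamma_integrand 1 x).
  rewrite /D0y/= in_itv/= andbT => x0.
  apply: is_derive_eq (is_deriveN (is_derive1_comp (is_derive_expR _)
    (is_deriveNid x 1))) _.
  by rewrite /Gamma_integrand subrr powRr0 mul1r mulrN1 opprK.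
have cf (x : R) : D0y x -> {for x, continuous (Gamma_integrand 1)}.
  by rewrite /D0y/= in_itv/= andbT; exact: continuous_Gamma_integrand.
have ff (x : R) : D0y x -> `|Gamma_integrand 1 x| <= Gamma_integrand 1 x.
  by rewrite ger0_norm// Gamma_integrand_ge0.
have [_ GE] := improper_FTC invSS_lt nab Dab ff cf cf dF dF cvgF cvgF.
by rewrite /Gamma [LHS]GE oppr0 add0r.
Qed.

Lemma powR_expRN_cvg a : 0 < a ->
  n.+1%:R `^ a * expR (- n.+1%:R)
  - n.+2%:R^-1 `^ a * expR (- n.+2%:R^-1) @[n --> \oo] --> (0 - 0 * 1 : R).
Proof.
move=> a0; apply: cvgB.
  (* Bounding the power a + 1 instead of a leaves a spare factor 1 / (1 + s), hence the bound K / (n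
     + 2), which tends to 0. *)
  pose K := expR ((a + 1) * ln (a + 1) + 1 - (a + 1)).
  apply: (@squeeze_cvgr _ _ _ _ (fun=> 0) (fun n => K * n.+2%:R^-1)); last 2 first.
  - exact: cvg_cst.
  - by rewrite -[X in _ --> X](mulr0 K); apply: cvgMr; exact: cvg_invSS.
  apply: nearW => n; rewrite mulr_ge0 ?powR_ge0 ?expR_ge0//=.
  have n1 : 0 < 1 + n.+1%:R :> R by rewrite addr_gt0.
  have le1 : (1 + n.+1%:R) `^ (a + 1) <= K * expR n.+1%:R.
    by apply: powR_1Ds_le; rewrite ?addr_gt0.
  rewrite powRS// in le1.
  rewrite -[n.+2%:R]natr1 [_ + 1]addrC ler_pdivlMr// expRN mulrAC ler_pdivrMr ?expR_gt0//.
  apply: le_trans le1; rewrite mulrC ler_pM2l// ge0_ler_powR ?nnegrE ?(ltW a0)// ?ltW//.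
  by rewrite ltrDr.
apply: cvgM; last exact: cvg_expRN_invSS.
have /cvg_at_rightP/(_ (fun n => n.+2%:R^-1)) := powR_cvg0 a0; apply.
by split => //; exact: cvg_invSS.
Qed.

(* s^a e^-s vanishes at 0 and at +oo. *)
Lemma GammaS a : 0 < a -> Gamma (a + 1) = a * Gamma a.
Proof.
move=> a0; have a1 : 0 < a + 1 by rewrite addr_gt0.
have [nab Dab] := exhaust_itv0y R.
have ia := integrable_Gamma_integrand a0.
have iaS := integrable_Gamma_integrand a1.
have [K K0 GK] := Gamma_integrand_le a0.
have [K1 K10 GK1] := Gamma_integrand_le a1.
pose Q := beta_prime_cdf.
pose f s := a * Gamma_integrand a s - Gamma_integrand (a + 1) s.
(* [f] is the derivative of s^a e^(-s) and changes sign; [g] adds up the majorants of its two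
   terms. *)
pose g s := a * K * beta_prime_density a s + K1 * beta_prime_density (a + 1) s.
have fg x : D0y x -> `|f x| <= g x.
  rewrite /D0y/= in_itv/= andbT => x0.
  apply: le_trans (ler_normB _ _) _; apply: lerD.
    by rewrite normrM !ger0_norm ?Gamma_integrand_ge0 ?(ltW a0)// -mulrA ler_pM2l// GK.
  by rewrite ger0_norm ?Gamma_integrand_ge0// GK1.
have cf x : D0y x -> {for x, continuous f}.
  rewrite /D0y/= in_itv/= andbT => x0; apply: cvgB.
    by apply: cvgMr; exact: continuous_Gamma_integrand.
  exact: continuous_Gamma_integrand.
have cg x : D0y x -> {for x, continuous g}.
  by rewrite /D0y/= in_itv/= andbT => x0; apply: cvgD; apply: cvgMr;
    exact: continuous_beta_prime_density.
have dF x : D0y x -> is_derive x 1 ((fun u : R => u `^ a) * (expR \o -%R)) (f x).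
  rewrite /D0y/= in_itv/= andbT => x0.
  have d1 := is_derive1_powR a x0.
  apply: is_derive_eq (is_deriveM d1 (is_derive1_comp (is_derive_expR _)
    (is_deriveNid x 1))) _.
  rewrite /f /Gamma_integrand addrK /GRing.scale /=; ring.
have dG x : D0y x -> is_derive x 1 ((a * K) *: Q a + K1 *: Q (a + 1)) (g x).
  rewrite /D0y/= in_itv/= andbT => x0.
  by apply: is_deriveD; apply: is_deriveZ; exact: is_derive_beta_prime.
have cvgF := powR_expRN_cvg a0.
have cvgG : ((a * K) *: Q a + K1 *: Q (a + 1)) n.+1%:R
    - ((a * K) *: Q a + K1 *: Q (a + 1)) n.+2%:R^-1 @[n --> \oo]
    --> (a * K * (1 - 0) + K1 * (1 - 0) : R).
  have cvgQ c : 0 < c -> Q c n.+1%:R - Q c n.+2%:R^-1 @[n --> \oo] --> (1 - 0 : R).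
    exact: beta_prime_cdf_cvg.
  rewrite [X in X @ _ --> _](_ : _ = fun n =>
    a * K * (Q a n.+1%:R - Q a n.+2%:R^-1) +
    K1 * (Q (a + 1) n.+1%:R - Q (a + 1) n.+2%:R^-1)).
    by apply: cvgD; apply: cvgMr; exact: cvgQ.
  by apply/funext => n; rewrite !fctE /GRing.scale /=; ring.
have [_ intf] := improper_FTC invSS_lt nab Dab fg cf cg dF dG cvgF cvgG.
have iZ : mu.-integrable D0y (EFin \o (fun s => a * Gamma_integrand a s)).
  by apply: (integrableZl _ _ ia); exact: measurable_itv.
move: intf; rewrite /f RintegralB//.
rewrite RintegralZl//.
by rewrite mul0r subr0 => /eqP; rewrite subr_eq0 => /eqP/esym.
Qed.

Lemma Gamma_natS n : Gamma n.+1%:R = n`!%:R :> R.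
Proof.
elim: n => [|n IH]; first by rewrite Gamma1.
by rewrite -[n.+2%:R]natr1 GammaS// IH factS natrM.
Qed.

End Gamma.

(** * Beta integrals and Caputo derivatives *)

(** Integrability is carried through the induction because additivity of the integral at each step
    asks for it on the remaining sum. *)
Lemma Rintegral_lincomb d (T : measurableType d) (R : realType)
    (mu : {measure set T -> \bar R}) (D : set T) (I : Type) (s : seq I)
    (c : I -> R) (f : I -> T -> R) :
  measurable D -> (forall i, mu.-integrable D (EFin \o f i)) ->
  mu.-integrable D (EFin \o (fun x => \sum_(i <- s) c i * f i x)) /\
  \int[mu]_(x in D) (\sum_(i <- s) c i * f i x) =
  \sum_(i <- s) c i * \int[mu]_(x in D) f i x.
Proof.
move=> mD intf; elim: s => [|i s [ints IH]].
  have E0 : (fun x => \sum_(i <- [::]) c i * f i x) = cst (0 : R).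
    by apply/funext => x; rewrite big_nil.
  split; last by rewrite E0 big_nil /Rintegral /= integral0.
  by rewrite E0; exact: integrable0.
have E : (fun x => \sum_(j <- i :: s) c j * f j x) =
    (fun x => c i * f i x + \sum_(j <- s) c j * f j x).
  by apply/funext => x; rewrite big_cons.
have intZ : mu.-integrable D (EFin \o (fun x => c i * f i x)).
  by apply: (integrableZl _ _ (intf i)).
split; first by rewrite E; exact: integrableD intZ ints.
by rewrite E big_cons RintegralD// RintegralZl// IH.
Qed.

Lemma cvg_invSSS (R : realType) : n.+3%:R^-1 @[n --> \oo] --> (0 : R).
Proof. have := @cvg_invSS R; rewrite -cvg_shiftS; exact. Qed.

Section BetaIntegral.
Context {R : realType}.
Notation mu := (@lebesgue_measure R).
Variables (t : R) (t_gt0 : 0 < t).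

Let D0t : set R := `]0, t[%classic.
(** Starting from t / 3 makes the interval from [u n] to [t - u n] nondegenerate for every n; t / 2
    would collapse it. *)
Let u n : R := t * n.+3%:R^-1.

Let u_gt0 n : 0 < u n. Proof. by rewrite mulr_gt0// invr_gt0. Qed.

Let cvg_u : u n @[n --> \oo] --> (0 : R).
Proof. by rewrite -[X in _ --> X](mulr0 t); apply: cvgMr; exact: cvg_invSSS. Qed.

Let cvg_tu : t - u n @[n --> \oo] --> t.
Proof. by rewrite -[X in _ --> X]subr0; apply: cvgB => //; exact: cvg_cst. Qed.

Let u_lt n : u n < t - u n.
Proof.
rewrite ltrBrDr -mulr2n -mulr_natr -mulrA gtr_pMr// mulrC.
by rewrite ltr_pdivrMr// mul1r ltr_nat.
Qed.

Let u_nonincr : nonincreasing_seq u.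
Proof.
by apply/nonincreasing_seqP => n; rewrite ler_pM2l// lef_pV2 ?posrE// ler_nat.
Qed.

Let exhaust0t :
  nondecreasing_seq (fun n => `[u n, t - u n]%classic : set R) /\
  \bigcup_n `[u n, t - u n]%classic = D0t.
Proof.
apply: exhaust_itvoo => //.
- by move=> n m nm; rewrite lerD2l lerN2 u_nonincr.
- by move=> n; rewrite gtrBl.
Qed.

Definition beta_integrand (a : R) (j : nat) (s : R) := s ^+ j * (t - s) `^ (a - 1).

Lemma is_derive_powR_subl (a s : R) : s < t ->
  is_derive s 1 ((fun v : R => v `^ a) \o (cst t - id)) (- (a * (t - s) `^ (a - 1))).
Proof.
move=> st; have ts : 0 < t - s by rewrite subr_gt0.
have d2 : is_derive ((cst t - id) s) 1 (fun v : R => v `^ a) (a * (t - s) `^ (a - 1)).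
  exact: is_derive1_powR.
have d3 : is_derive s 1 (cst t - id) (0 - 1 : R) by exact: is_deriveB.
apply: is_derive_eq (is_derive1_comp d2 d3) _.
by rewrite sub0r mulrN1.
Qed.

Lemma continuous_powR_subl (a s : R) : s < t ->
  {for s, continuous (fun v => (t - v) `^ a)}.
Proof. by move=> /(is_derive_powR_subl a)/is_derive_continuous. Qed.

Lemma continuous_beta_integrand a j s : s < t ->
  {for s, continuous (beta_integrand a j)}.
Proof.
move=> st; apply: cvgM; last exact: continuous_powR_subl.
exact: exprn_continuous.
Qed.

(** All j are thereby dominated by the case j = 0, the one with an elementary primitive. *)
Lemma beta_integrand_le a j s : s \in `]0, t[ ->
  0 <= beta_integrand a j s <= t ^+ j * beta_integrand a 0 s.
Proof.
rewrite in_itv/= => /andP[s0 st].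
rewrite /beta_integrand expr0 mul1r mulr_ge0 ?powR_ge0 ?exprn_ge0 ?(ltW s0)//=.
by rewrite ler_wpM2r ?powR_ge0// lerXn2r ?nnegrE ?ltW.
Qed.

Definition beta0_primitive (a : R) : R -> R :=
  (- a^-1) *: ((fun v : R => v `^ a) \o (cst t - id)).

Lemma is_derive_beta0 a s : 0 < a -> s < t ->
  is_derive s 1 (beta0_primitive a) (beta_integrand a 0 s).
Proof.
move=> a0 st; apply: is_derive_eq (is_deriveZ _ (is_derive_powR_subl a st)) _.
by rewrite /beta_integrand expr0 mul1r /GRing.scale/= mulrNN mulKf ?gt_eqF.
Qed.

Lemma cvg_powR_u a : 0 < a -> u n `^ a @[n --> \oo] --> (0 : R).
Proof.
by move=> a0; have /cvg_at_rightP/(_ u) := powR_cvg0 a0; apply; split.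
Qed.

Lemma cvg_powR_tu a : (t - u n) `^ a @[n --> \oo] --> t `^ a.
Proof.
have := @continuous_cvg _ _ _ _ _ _ (fun v : R => v `^ a) _
  (@continuous_powR _ a _ t_gt0) cvg_tu.
by apply.
Qed.

Lemma cvg_beta0 a : 0 < a ->
  beta0_primitive a (t - u n) - beta0_primitive a (u n) @[n --> \oo]
  --> - a^-1 * 0 - (- a^-1) * t `^ a.
Proof.
move=> a0.
rewrite [X in X @ _ --> _](_ : _ = fun n =>
  - a^-1 * u n `^ a - (- a^-1) * (t - u n) `^ a); last first.
  by apply/funext => n; rewrite /beta0_primitive !fctE /GRing.scale/= subKr.
by apply: cvgB; apply: cvgMr; [exact: cvg_powR_u|exact: cvg_powR_tu].
Qed.

Let in_D0t s : D0t s -> [/\ 0 < s, s < t & s \in `]0, t[].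
Proof. by rewrite /D0t/= => st; split => //; move: st; rewrite in_itv => /andP[]. Qed.

Lemma Rintegral_beta0 a : 0 < a ->
  mu.-integrable D0t (EFin \o beta_integrand a 0) /\
  \int[mu]_(s in D0t) beta_integrand a 0 s = t `^ a / a.
Proof.
move=> a0; have [nab Dab] := exhaust0t.
have ff s : D0t s -> `|beta_integrand a 0 s| <= beta_integrand a 0 s.
  by move=> /in_D0t[_ _ /(beta_integrand_le a 0)/andP[b0 _]]; rewrite ger0_norm.
have cf s : D0t s -> {for s, continuous (beta_integrand a 0)}.
  by move=> /in_D0t[_ + _]; exact: continuous_beta_integrand.
have dF s : D0t s -> is_derive s 1 (beta0_primitive a) (beta_integrand a 0 s).
  by move=> /in_D0t[_ + _]; exact: is_derive_beta0.
have [ib bE] := improper_FTC u_lt nab Dab ff cf cf dF dF (cvg_beta0 a0) (cvg_beta0 a0).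
by split => //; rewrite bE mulr0 sub0r mulNr opprK mulrC.
Qed.

Lemma integrable_beta_integrand a j : 0 < a ->
  mu.-integrable D0t (EFin \o beta_integrand a j).
Proof.
move=> a0; have [ib _] := Rintegral_beta0 a0; have [nab Dab] := exhaust0t.
apply: le_integrable (integrableZl _ (t ^+ j) ib) => //; try exact: measurable_itv.
- apply/measurable_EFinP; apply: (exhaust_measurable_fun Dab) => s.
  by move=> /in_D0t[_ + _]; exact: continuous_beta_integrand.
- move=> s /in_D0t[_ _ sD].
  have /andP[bj0 bj] := beta_integrand_le a j sD.
  have /andP[b0 _] := beta_integrand_le a 0 sD.
  by rewrite lee_fin !ger0_norm// mulr_ge0// exprn_ge0// ltW.
Qed.

(* s^(j+1) (t - s)^a vanishes at 0 and at t. *)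
Lemma Rintegral_beta_integrandS a j : 0 < a ->
  (a + j.+1%:R) * \int[mu]_(s in D0t) beta_integrand a j.+1 s =
  j.+1%:R * t * \int[mu]_(s in D0t) beta_integrand a j s.
Proof.
move=> a0; have [nab Dab] := exhaust0t.
have aj0 : 0 <= a + j.+1%:R by rewrite addr_ge0// ltW.
have jt0 : 0 <= j.+1%:R * t by rewrite mulr_ge0// ltW.
(* This is the derivative of s^(j+1) (t - s)^a once (t - s)^a is written as (t - s) (t - s)^(a - 1);
   [C] collects the bounds of its two terms. *)
pose f s := j.+1%:R * t * beta_integrand a j s - (a + j.+1%:R) * beta_integrand a j.+1 s.
pose C := j.+1%:R * t * t ^+ j + (a + j.+1%:R) * t ^+ j.+1.
have fg s : D0t s -> `|f s| <= C * beta_integrand a 0 s.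
  move=> /in_D0t[_ _ sD].
  have /andP[bj0 bj] := beta_integrand_le a j sD.
  have /andP[bS0 bS] := beta_integrand_le a j.+1 sD.
  rewrite mulrDl; apply: le_trans (ler_normB _ _) _; apply: lerD.
    by rewrite normrM !ger0_norm// -mulrA ler_wpM2l.
  by rewrite normrM !ger0_norm// -mulrA ler_wpM2l.
have cf s : D0t s -> {for s, continuous f}.
  by move=> /in_D0t[_ st _]; apply: cvgB; apply: cvgMr; exact: continuous_beta_integrand.
have cg s : D0t s -> {for s, continuous (fun s => C * beta_integrand a 0 s)}.
  by move=> /in_D0t[_ st _]; apply: cvgMr; exact: continuous_beta_integrand.
have dF s : D0t s ->
    is_derive s 1 ((@id R) ^+ j.+1 * ((fun v : R => v `^ a) \o (cst t - id))) (f s).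
  move=> /in_D0t[_ st _].
  apply: is_derive_eq (is_deriveM (is_deriveX j.+1 (is_derive_id s 1))
    (is_derive_powR_subl a st)) _.
  have ts : 0 < t - s by rewrite subr_gt0.
  rewrite /f /beta_integrand !fctE /GRing.scale/=.
  rewrite -[in X in _ + X](subrK 1 a) powRS// exprS.
  by rewrite -!natr1; ring.
have dG s : D0t s ->
    is_derive s 1 (C *: beta0_primitive a) (C * beta_integrand a 0 s).
  by move=> /in_D0t[_ st _]; apply: is_deriveZ; exact: is_derive_beta0.
have cvgF : ((@id R) ^+ j.+1 * ((fun v : R => v `^ a) \o (cst t - id))) (t - u n)
    - ((@id R) ^+ j.+1 * ((fun v : R => v `^ a) \o (cst t - id))) (u n) @[n --> \oo]
    --> t ^+ j.+1 * 0 - 0 ^+ j.+1 * t `^ a.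
  rewrite [X in X @ _ --> _](_ : _ = fun n =>
    (t - u n) ^+ j.+1 * u n `^ a - u n ^+ j.+1 * (t - u n) `^ a); last first.
    by apply/funext => n; rewrite !fctE /= subKr.
  apply: cvgB; apply: cvgM.
  - apply: (@continuous_cvg _ _ _ _ _ _ (fun v : R => v ^+ j.+1) _ _ cvg_tu).
    exact: exprn_continuous.
  - exact: cvg_powR_u.
  - apply: (@continuous_cvg _ _ _ _ _ _ (fun v : R => v ^+ j.+1) _ _ cvg_u).
    exact: exprn_continuous.
  - exact: cvg_powR_tu.
have cvgG : (C *: beta0_primitive a) (t - u n)
    - (C *: beta0_primitive a) (u n) @[n --> \oo]
    --> C * (- a^-1 * 0 - (- a^-1) * t `^ a).
  rewrite [X in X @ _ --> _](_ : _ = fun n =>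
    C * (beta0_primitive a (t - u n) - beta0_primitive a (u n))); last first.
    by apply/funext => n; rewrite !fctE /GRing.scale/= mulrBr.
  by apply: cvgMr; exact: cvg_beta0.
have [_ intf] := improper_FTC u_lt nab Dab fg cf cg dF dG cvgF cvgG.
have ij := integrable_beta_integrand j a0.
have iS := integrable_beta_integrand j.+1 a0.
have iZj : mu.-integrable D0t (EFin \o (fun s => j.+1%:R * t * beta_integrand a j s)).
  by apply: (integrableZl _ _ ij); exact: measurable_itv.
have iZS : mu.-integrable D0t
    (EFin \o (fun s => (a + j.+1%:R) * beta_integrand a j.+1 s)).
  by apply: (integrableZl _ _ iS); exact: measurable_itv.
move: intf; rewrite /f RintegralB//; try exact: measurable_itv.
rewrite (RintegralZl _ _ ij) ?(RintegralZl _ _ iS); try exact: measurable_itv.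
by rewrite mulr0 expr0n mul0r subr0 => /eqP; rewrite subr_eq0 => /eqP/esym.
Qed.

(** The value is t^(a + j) B(j + 1, a). The Gamma quotient appears as a finite product, the one that
    [GammaD_nat] produces. *)
Lemma Rintegral_beta_integrand a j : 0 < a ->
  \int[mu]_(s in D0t) beta_integrand a j s =
  t `^ (a + j%:R) * j`!%:R / \prod_(i < j.+1) (a + i%:R).
Proof.
move=> a0; elim: j => [|j IH].
  by rewrite (Rintegral_beta0 a0).2 big_ord1 addr0 mulr1.
have aj0 : a + j.+1%:R != 0 by rewrite gt_eqF// addr_gt0.
apply: (mulfI aj0); rewrite Rintegral_beta_integrandS// IH.
have -> : t `^ (a + j.+1%:R) = t * t `^ (a + j%:R) by rewrite -natr1 addrA powRS.
rewrite [in RHS]big_ord_recr/= factS natrM; set P := (\prod_(i < _) _).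
have P0 : P != 0.
  by rewrite /P prodf_seq_neq0; apply/allP => i _ /=; rewrite gt_eqF// ltr_wpDr.
by field; rewrite P0 [1 + _]addrC natr1 aj0.
Qed.

End BetaIntegral.

Lemma GammaD_nat (R : realType) (a : R) j : 0 < a ->
  Gamma (a + j%:R) = \prod_(i < j) (a + i%:R) * Gamma a.
Proof.
move=> a0; elim: j => [|j IH]; first by rewrite big_ord0 addr0 mul1r.
have aj0 : 0 < a + j%:R by rewrite ltr_wpDr.
rewrite -natr1 addrA (GammaS aj0) IH big_ord_recr/= mulrA.
by rewrite [(_ + _) * _]mulrC.
Qed.

(** * Caputo derivatives of polynomials *)

Lemma derive1n_horner (R : realType) (p : {poly R}) q :
  derive1n q (horner p) = horner p^`(q).
Proof.
elim: q p => [|q IH] p; first by rewrite derivn0.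
by rewrite derivnS derivE -IH derive1nS.
Qed.

(** For i < q the falling factorial is 0, so the truncated exponent i - q does no harm. *)
Lemma horner_derivn (R : realType) (p : {poly R}) q (x : R) :
  p^`(q).[x] = \sum_(i < size p) p`_i * ((i ^_ q)%:R * x ^+ (i - q)).
Proof.
rewrite -[in LHS](coefK p) poly_def linear_sum /= horner_sum.
apply: eq_bigr => i _.
by rewrite derivnZ derivnXn hornerZ hornerMn hornerXn mulr_natl.
Qed.

(** Each coefficient gets multiplied by the diagonal entry of [Gmx] for its exponent. With a = q -
    th, the power t^i contributes the beta integral of index i - q. *)
Lemma caputo_horner (R : realType) (q : nat) (th t : R) (p : {poly R}) :
  q%:R - 1 < th <= q%:R -> 0 < t ->
  caputo q th (horner p) t =
  \sum_(i < size p) p`_i *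
    ((if (q <= i)%N then t `^ (- th) * (i`!%:R / Gamma (i%:R - th + 1)) else 0)
     * t ^+ i).
Proof.
move=> /andP[qth thq] t0.
rewrite /caputo derive1n_horner; have [->|thq'] := eqVneq th q%:R.
  rewrite horner_derivn; apply: eq_bigr => i _; congr (_ * _).
  case: ifPn => [qi|]; last by rewrite -ltnNge => /ffact_small ->; rewrite !mul0r.
  (* At integer order the Gamma factor is (i - q)!, and i! / (i - q)! is the falling factorial of
     the ordinary derivative. *)
  rewrite -natrB// natr1 Gamma_natS powRN powR_mulrn ?(ltW t0)//.
  rewrite -(ffact_fact qi) natrM mulfK ?pnatr_eq0 -?lt0n ?fact_gt0//.
  rewrite mulrAC mulrC; congr (_ * _).
  by rewrite expfB_cond ?(gt_eqF t0)// mulrC.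
pose a := q%:R - th.
have a0 : 0 < a by rewrite subr_gt0 lt_neqAle thq'.
have -> : q%:R - 1 - th = a - 1 by rewrite /a addrAC.
pose c (i : 'I_(size p)) := p`_i * (i ^_ q)%:R.
pose b (i : 'I_(size p)) := beta_integrand t a (i - q).
have ib i : (@lebesgue_measure R).-integrable `]0, t[ (EFin \o b i).
  exact: integrable_beta_integrand.
have lin mD := Rintegral_lincomb (index_enum _) c mD ib.
have [intS intSE] := lin (measurable_itv _).
(* The definition integrates over the closed interval and the beta integral over the open one; the
   endpoints are negligible. *)
have -> : \int[@lebesgue_measure R]_(s in `[0, t])
    ((t - s) `^ (a - 1) * (p^`(q)).[s]) =
    \int[@lebesgue_measure R]_(s in `]0, t[) (\sum_i c i * b i s).
  transitivity (\int[@lebesgue_measure R]_(s in `[0, t]) (\sum_i c i * b i s)).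
    apply: eq_Rintegral => s _.
    rewrite horner_derivn mulr_sumr; apply: eq_bigr => i _.
    by rewrite /c /b /beta_integrand; ring.
  by rewrite /Rintegral integral_itv_bndoo//; exact: measurable_int intS.
rewrite intSE mulr_sumr; apply: eq_bigr => i _.
rewrite /c -!mulrA mulrCA; congr (_ * _).
case: ifPn => [qi|]; last by rewrite -ltnNge => /ffact_small ->; rewrite !mul0r mulr0.
rewrite Rintegral_beta_integrand//.
have -> : i%:R - th + 1 = a + (i - q).+1%:R.
  by rewrite -natr1 natrB// /a; ring.
(* Both sides now carry the same inverses: the product comes from the beta integral, [Gamma a] from
   the prefactor of the derivative. *)
rewrite GammaD_nat// -(ffact_fact qi) natrM.
have -> : t `^ (a + (i - q)%:R) = t `^ (- th) * t ^+ i.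
  rewrite -powR_mulrn ?(ltW t0)// -powRD; last by rewrite (gt_eqF t0) implybT.
  by rewrite natrB// /a; congr (_ `^ _); ring.
by rewrite invfM; ring.
Qed.

(** * Shifted Chebyshev polynomials *)

Section ShiftedChebyshev.
Context {R : realType}.

Definition shifted_chebyshev_coef (m i : nat) : R :=
  m%:R * ((-1) ^+ (m - i) * (2 ^ (2 * i) * (m + i - 1)`!)%:R
          / ((m - i)`! * (2 * i)`!)%:R).

Definition shifted_chebyshev_poly (m : nat) : {poly R} :=
  if m is 0 then 1 else \poly_(i < m.+1) shifted_chebyshev_coef m i.

Lemma horner_shifted_chebyshev m t :
  (shifted_chebyshev_poly m).[t] = shifted_chebyshev m t.
Proof.
case: m => [|m]; first by rewrite hornerC.
rewrite horner_poly /= mulr_sumr; apply: eq_bigr => i _.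
by rewrite /shifted_chebyshev_coef -!mulrA.
Qed.

Lemma size_shifted_chebyshev_poly m : (size (shifted_chebyshev_poly m) <= m.+1)%N.
Proof. by case: m => [|m]; [rewrite size_poly1|exact: size_poly]. Qed.

(* Indexing by j = m - i avoids the truncated subtraction m - i. *)
Let coefT (i j : nat) : R := shifted_chebyshev_coef (i + j) i.

Let coefTE i j : coefT i j = (i + j)%:R *
  ((-1) ^+ j * (2 ^+ (2 * i) * (2 * i + j).-1`!%:R) / (j`!%:R * (2 * i)`!%:R)).
Proof.
rewrite /coefT /shifted_chebyshev_coef [(i + j - i)%N]addKn !natrM natrX.
by rewrite subn1 addnAC addnn -mul2n.
Qed.

Let natr_fact_neq0 n : n`!%:R != 0 :> R.
Proof. by rewrite pnatr_eq0 -lt0n fact_gt0. Qed.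

Let factSE n : n.+1`!%:R = (1 + n%:R) * n`!%:R :> R.
Proof. by rewrite factS natrM -natr1 [_ + 1]addrC. Qed.

Let coefT0S j : coefT 0 j.+1 = (-1) ^+ j.+1.
Proof.
rewrite coefTE !muln0 expr0 !add0n fact0 /= factSE -natr1.
by field; rewrite natr_fact_neq0 [1 + _]addrC natr1 pnatr_eq0.
Qed.

Let coefTS0 i : coefT i.+1 0 = 2 ^+ (2 * i.+1) / 2.
Proof.
rewrite coefTE !addn0 expr0 mulnS /= !factSE -!natr1 natrM.
by field; rewrite natr_fact_neq0; have := ler0n R i => i0;
  rewrite !gt_eqF//; lra.
Qed.

(** Coefficient of t^(i+1) in T*_(m+2) = (4 t - 2) T*_(m+1) - T*_m, where m = i + j + 1. Peeling the
    factorials down to (2i + j)!, (2i)! and j! leaves a rational identity in i and j. *)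
Let coefTSS i j :
  coefT i.+1 j.+2 = 4 * coefT i j.+2 - 2 * coefT i.+1 j.+1 - coefT i.+1 j.
Proof.
have natrS n : n.+1%:R = 1 + n%:R :> R by rewrite -natr1 addrC.
rewrite !coefTE mulnS !addnS !addSn add0n /= !factSE.
rewrite (natrS (2 * i + j).+1) (natrS (2 * i + j)%N) (natrS (2 * i)%N) (natrS j).
rewrite (natrS (i + j).+2) (natrS (i + j).+1) (natrS (i + j)%N).
rewrite (natrD _ i j) (natrD _ (2 * i)%N j) (natrM _ 2 i) !exprS.
have [i0 j0] := (ler0n R i, ler0n R j).
field.
by rewrite !natr_fact_neq0 /=; apply/and4P; split; rewrite gt_eqF//; lra.
Qed.

(** The same in degree m + 1, where T*_m no longer contributes. *)
Let coefTS1 i : coefT i.+1 1 = 4 * coefT i 1 - 2 * coefT i.+1 0.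
Proof.
rewrite coefTS0 !coefTE mulnS !addnS !addSn add0n !addn0 /= !factSE fact0.
rewrite -[(2 * i).+1%:R]natr1 -[i.+2%:R]natr1 -[i.+1%:R]natr1 natrM !exprS expr0.
have i0 := ler0n R i.
field.
by rewrite !natr_fact_neq0 /=; apply/andP; split; rewrite gt_eqF//; lra.
Qed.

(** This is T_(m+2) = 2 y T_(m+1) - T_m at y = 2 t - 1. The constant term and the degrees from m + 1
    on are treated apart, since there some of the terms drop out. *)
Lemma shifted_chebyshev_polySS m : shifted_chebyshev_poly m.+2 =
  4 *: ('X * shifted_chebyshev_poly m.+1) - 2 *: shifted_chebyshev_poly m.+1
  - shifted_chebyshev_poly m.
Proof.
apply/polyP => i; rewrite !coefB !coefZ coefXM.
have coef_cheb l n : (shifted_chebyshev_poly l.+1)`_n =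
    if (n <= l.+1)%N then coefT n (l.+1 - n) else 0.
  by rewrite coef_poly ltnS; case: ifP => // nl; rewrite /coefT subnKC.
have coefT_shift n : coefT n.+1 0 = 4 * (if n is 0 then 2^-1 else coefT n 0).
  case: n => [|n]; first by rewrite coefTS0 expr2; field.
  by rewrite !coefTS0 [in LHS]mulnS exprD; field.
(* T*_0 = 1 is not an instance of the coefficient formula, whose factor m vanishes there. *)
case: m => [|m]; rewrite !coef_cheb ?coef1.
  case: i => [|[|[|i]]] /=; rewrite ?subn0 ?subnn.
  - by rewrite !coefT0S; ring.
  - by rewrite coefTS1; ring.
  - by rewrite coefT_shift; ring.
  - by ring.
case: i => [|i]; first by rewrite /= !subn0 !coefT0S !exprS; ring.
rewrite /= !subSS.
have [im|] := leqP i m.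
  have -> : (m.+2 - i = (m - i).+2)%N by lia.
  have -> : (m.+1 - i = (m - i).+1)%N by lia.
  have [-> ->] : (i < m.+3)%N /\ (i <= m.+2)%N by lia.
  by rewrite !ltnS im leqW // coefTSS.
rewrite leq_eqVlt => /predU1P[<-|].
  have [-> -> ->] : [/\ (m.+1 < m.+3)%N, (m.+1 <= m.+2)%N & (m.+1 < m.+2)%N]
    by split; lia.
  by rewrite ltnn subSnn subnn coefTS1 subr0.
rewrite leq_eqVlt => /predU1P[<-|im].
  have [-> -> -> ->] : [/\ (m.+2 < m.+3)%N, (m.+2 <= m.+2)%N,
    (m.+2 < m.+2)%N = false & (m.+2 < m.+1)%N = false] by split; lia.
  by rewrite subnn coefT_shift mulr0 !subr0.
have [-> -> -> ->] : [/\ (i < m.+3)%N = false, (i <= m.+2)%N = false,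
  (i < m.+2)%N = false & (i < m.+1)%N = false] by split; lia.
by rewrite !mulr0 !subr0.
Qed.

(** At t = (1 + cos x) / 2 the factor 4 t - 2 is 2 cos x, and the recurrence becomes the addition
    formula for cos ((m + 1) x + x) and cos ((m + 1) x - x). Two consecutive indices are proved
    together. *)
Lemma shifted_chebyshev_cos m (x : R) :
  (shifted_chebyshev_poly m).[(1 + cos x) / 2] = cos (m%:R * x).
Proof.
suff : (shifted_chebyshev_poly m).[(1 + cos x) / 2] = cos (m%:R * x) /\
  (shifted_chebyshev_poly m.+1).[(1 + cos x) / 2] = cos (m.+1%:R * x) by case.
elim: m => [|m [IH IHS]].
  rewrite hornerC mul0r cos0 mul1r; split => //.
  rewrite horner_poly big_ord_recl big_ord1 /=.
  rewrite -[shifted_chebyshev_coef 1 0]/(coefT 0 1) coefT0S.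
  rewrite -[shifted_chebyshev_coef 1 _]/(coefT 1 0) coefTS0.
  by rewrite /bump /= mulr1; field.
split => //; rewrite shifted_chebyshev_polySS.
rewrite !(hornerD, hornerN, hornerZ, hornerM, hornerX) IH IHS.
have -> : m.+2%:R * x = m.+1%:R * x + x by rewrite -[m.+2%:R]natr1 mulrDl mul1r.
have -> : m%:R * x = m.+1%:R * x - x by rewrite -[m.+1%:R]natr1 mulrDl mul1r addrK.
by rewrite cosB cosD; field.
Qed.

End ShiftedChebyshev.

(** * Orthogonality of cosines for the Chebyshev weight *)

Section ChebyshevWeight.
Context {R : realType}.
Notation mu := (@lebesgue_measure R).
Variables k n : nat.

(** The piece is taken open: at its endpoints [piece_coord] is -1 or 1, where acos is not
    differentiable. *)
Let D : set R := `]n%:R / 2 ^+ k, n.+1%:R / 2 ^+ k[%classic.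

Definition piece_coord (t : R) : R := 2 ^+ k.+1 * t - (2 * n)%:R - 1.

Definition piece_weight (t : R) : R := (Num.sqrt (1 - piece_coord t ^+ 2))^-1.

Let pow_gt0 m : 0 < 2 ^+ m :> R. Proof. by rewrite exprn_gt0. Qed.

Lemma piece_coord_itv t : D t -> -1 < piece_coord t < 1.
Proof.
rewrite /D/= in_itv/= ltr_pdivrMr// ltr_pdivlMr// -[n.+1%:R]natr1 => /andP[nt tn].
rewrite /piece_coord exprS natrM.
have {nt tn} [nt tn] : n%:R < 2 ^+ k * t /\ 2 ^+ k * t < n%:R + 1.
  by rewrite ![2 ^+ k * t]mulrC.
by rewrite -mulrA; apply/andP; split; lra.
Qed.

Lemma one_sub_sqr_piece_coord_gt0 t : D t -> 0 < 1 - piece_coord t ^+ 2.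
Proof.
move=> /piece_coord_itv /andP[y1 y2].
have -> : 1 - piece_coord t ^+ 2 = (1 - piece_coord t) * (1 + piece_coord t) by ring.
by rewrite mulr_gt0//; lra.
Qed.

Lemma is_derive_piece_coord (t : R) : is_derive t 1 piece_coord (2 ^+ k.+1).
Proof.
rewrite (_ : piece_coord = (2 ^+ k.+1) *: id + cst (- (2 * n)%:R - 1)); last first.
  by apply/funext => x; rewrite /piece_coord !fctE /GRing.scale/= addrA.
by apply: is_derive_eq; rewrite addr0 /GRing.scale/= mulr1.
Qed.

Definition piece_angle (t : R) : R := acos (piece_coord t).

(** Up to a constant the weight is the derivative of the angle, so any function of the angle with a
    known primitive can be integrated against it. *)
Lemma is_derive_piece_angle t : D t ->
  is_derive t 1 piece_angle (- (piece_weight t * 2 ^+ k.+1)).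
Proof.
move=> Dt.
apply: is_derive_eq (is_derive1_comp (is_derive1_acos (piece_coord_itv Dt))
  (is_derive_piece_coord t)) _.
by rewrite mulNr.
Qed.

Lemma cos_piece_angle t : D t -> cos (piece_angle t) = piece_coord t.
Proof.
move=> /piece_coord_itv/andP[y1 y2]; rewrite acosK// in_itv/=.
by rewrite !ltW.
Qed.

Lemma shifted_chebyshev_piece m t : D t ->
  shifted_chebyshev m (2 ^+ k * t - n%:R) = cos (m%:R * piece_angle t).
Proof.
move=> Dt; rewrite -shifted_chebyshev_cos horner_shifted_chebyshev cos_piece_angle//.
by congr shifted_chebyshev; rewrite /piece_coord exprS natrM; field.
Qed.

(* The endpoints a_ m and b_ m have angles pi - x_ m and x_ m. *)
Let x_ (m : nat) : R := pi / m.+3%:R.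
Let a_ m : R := (- cos (x_ m) + 1 + (2 * n)%:R) / 2 ^+ k.+1.
Let b_ m : R := (cos (x_ m) + 1 + (2 * n)%:R) / 2 ^+ k.+1.

Let x_gt0 m : 0 < x_ m. Proof. by rewrite divr_gt0 ?pi_gt0. Qed.

(** The denominators start at 3 for this strict bound: it makes cos (x_ m) positive, which separates
    [a_ m] from [b_ m]. *)
Let x_lt m : x_ m < pi / 2.
Proof. by rewrite ltr_pM2l ?pi_gt0// ltf_pV2 ?posrE// ltr_nat. Qed.

Let x_le_pi m : x_ m <= pi.
Proof. by rewrite ler_pdivrMr// ler_peMr ?pi_ge0// ler1n. Qed.

Let cvg_x : x_ m @[m --> \oo] --> (0 : R).
Proof.
by rewrite -[X in _ --> X](mulr0 pi); apply: cvgMr; exact: cvg_invSSS.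
Qed.

Let cosx_gt0 m : 0 < cos (x_ m).
Proof.
apply: cos_gt0_pihalf; rewrite x_lt andbT (lt_trans _ (x_gt0 m))//.
by rewrite oppr_lt0 divr_gt0 ?pi_gt0.
Qed.

Let cosx_lt1 m : cos (x_ m) < 1.
Proof.
rewrite -cos0 ltr_cos ?x_gt0// in_itv/= ?lexx ?pi_ge0//.
by rewrite (ltW (x_gt0 m)) x_le_pi.
Qed.

Let cosx_nondecr : nondecreasing_seq (fun m => cos (x_ m)).
Proof.
apply/nondecreasing_seqP => m; rewrite ltW// ltr_cos ?in_itv/=.
- by rewrite ltr_pM2l ?pi_gt0// ltf_pV2 ?posrE// ltr_nat.
- by rewrite (ltW (x_gt0 _)) x_le_pi.
- by rewrite (ltW (x_gt0 _)) x_le_pi.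
Qed.

Let piece_coord_a m : piece_coord (a_ m) = - cos (x_ m).
Proof. by rewrite /piece_coord /a_ mulrC divfK ?gt_eqF//; ring. Qed.

Let piece_coord_b m : piece_coord (b_ m) = cos (x_ m).
Proof. by rewrite /piece_coord /b_ mulrC divfK ?gt_eqF//; ring. Qed.

Let piece_angle_b m : piece_angle (b_ m) = x_ m.
Proof.
by rewrite /piece_angle piece_coord_b cosK// in_itv/= (ltW (x_gt0 _)) x_le_pi.
Qed.

Let piece_angle_a m : piece_angle (a_ m) = pi - x_ m.
Proof.
rewrite /piece_angle piece_coord_a acosN ?cosK// ?in_itv/=.
  by rewrite (ltW (x_gt0 _)) x_le_pi.
by rewrite cos_geN1 cos_le1.
Qed.

Let a_lt_b m : a_ m < b_ m.
Proof.
rewrite ltr_pM2r ?invr_gt0// -!addrA ltrD2r.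
by have := cosx_gt0 m; lra.
Qed.

Let cvg_cosx : cos (x_ m) @[m --> \oo] --> (1 : R).
Proof.
have := @continuous_cvg _ _ _ _ _ _ cos _ (@continuous_cos R 0) cvg_x.
by rewrite cos0; apply.
Qed.

Let exhaustD :
  nondecreasing_seq (fun m => `[a_ m, b_ m]%classic : set R) /\
  \bigcup_m `[a_ m, b_ m]%classic = D.
Proof.
apply: exhaust_itvoo.
- move=> i j ij; rewrite ler_pM2r ?invr_gt0// !lerD2r lerN2.
  exact: cosx_nondecr.
- move=> i j ij; rewrite ler_pM2r ?invr_gt0// !lerD2r.
  exact: cosx_nondecr.
- move=> m; rewrite /a_ exprS invfM mulrA ltr_pM2r ?invr_gt0//.
  by rewrite natrM; have := cosx_lt1 m; lra.
- move=> m; rewrite /b_ exprS invfM mulrA ltr_pM2r ?invr_gt0//.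
  by rewrite natrM -[n.+1%:R]natr1; have := cosx_lt1 m; lra.
- have -> : n%:R / 2 ^+ k = (- 1 + 1 + (2 * n)%:R) / 2 ^+ k.+1 :> R.
    by rewrite exprS natrM; field; rewrite gt_eqF.
  by apply: cvgMl; apply: cvgD; [|exact: cvg_cst]; apply: cvgD; [|exact: cvg_cst];
    apply: cvgN.
- have -> : n.+1%:R / 2 ^+ k = (1 + 1 + (2 * n)%:R) / 2 ^+ k.+1 :> R.
    by rewrite exprS natrM -[n.+1%:R]natr1; field; rewrite gt_eqF.
  by apply: cvgMl; apply: cvgD; [|exact: cvg_cst]; apply: cvgD; [|exact: cvg_cst].
Qed.

Lemma continuous_piece_angle t : D t -> {for t, continuous piece_angle}.
Proof. by move=> /is_derive_piece_angle/is_derive_continuous. Qed.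

Lemma piece_weight_ge0 t : 0 <= piece_weight t.
Proof. by rewrite invr_ge0 sqrtr_ge0. Qed.

Lemma continuous_piece_weight t : D t -> {for t, continuous piece_weight}.
Proof.
move=> Dt; have w0 := one_sub_sqr_piece_coord_gt0 Dt.
have cy := is_derive_continuous (is_derive_piece_coord t).
apply: cvgV; first by rewrite gt_eqF// sqrtr_gt0.
have c1 : {for t, continuous (fun x => 1 - piece_coord x ^+ 2)}.
  by apply: cvgB; [exact: cvg_cst|apply: cvgM].
exact: continuous_comp c1 (@sqrt_continuous _ _).
Qed.

(** The frequency is real so that i + j and i - j can both be inserted. For c = 0 the primitive is
    the angle, of total variation pi; otherwise it is the sine of c times the angle, divided by
    c. *)
Lemma integral_piece_weight_cos (c : R) :
  mu.-integrable D (EFin \o (fun t => cos (c * piece_angle t) * piece_weight t)) /\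
  \int[mu]_(t in D) (cos (c * piece_angle t) * piece_weight t) =
  (if c == 0 then pi else sin (c * pi) / c) / 2 ^+ k.+1.
Proof.
have [nD DD] := exhaustD.
pose G := (- (2 ^+ k.+1)^-1) *: piece_angle.
have dG t : D t -> is_derive t 1 G (piece_weight t).
  move=> Dt; apply: is_derive_eq (is_deriveZ _ (is_derive_piece_angle Dt)) _.
  by rewrite /GRing.scale/= mulrNN mulrC mulfK// gt_eqF.
have cvgG : G (b_ m) - G (a_ m) @[m --> \oo] --> (- (2 ^+ k.+1)^-1 * (0 - (pi - 0)) : R).
  rewrite [X in X @ _ --> _](_ : _ = fun m =>
    - (2 ^+ k.+1)^-1 * (x_ m - (pi - x_ m))); last first.
    by apply/funext => m; rewrite /G !fctE piece_angle_b piece_angle_a -scalerBr.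
  by apply: cvgMr; apply: cvgB => //; apply: cvgB => //; exact: cvg_cst.
have cw := continuous_piece_weight.
have ccos t : D t -> {for t, continuous (fun t => cos (c * piece_angle t))}.
  move=> Dt; have cc : {for t, continuous (fun t => c * piece_angle t)}.
    by apply: cvgMr; exact: continuous_piece_angle.
  exact: continuous_comp cc (@continuous_cos _ _).
have cf t : D t ->
    {for t, continuous (fun t => cos (c * piece_angle t) * piece_weight t)}.
  by move=> Dt; apply: cvgM; [exact: ccos|exact: cw].
have fg t : D t -> `|cos (c * piece_angle t) * piece_weight t| <= piece_weight t.
  move=> _; rewrite normrM (ger0_norm (piece_weight_ge0 t)) ler_piMl ?piece_weight_ge0//.
  by rewrite ler_norml cos_geN1 cos_le1.
have [c0|c0] := eqVneq c 0.
  have dF t : D t -> is_derive t 1 G (cos (c * piece_angle t) * piece_weight t).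
    by rewrite c0 mul0r cos0 mul1r; exact: dG.
  have [intf ->] := improper_FTC a_lt_b nD DD fg cf cw dF dG cvgG cvgG.
  by split => //; rewrite subr0 sub0r mulrNN mulrC.
pose F := (- (c * 2 ^+ k.+1)^-1) *: (sin \o (c *: piece_angle)).
have dF t : D t -> is_derive t 1 F (cos (c * piece_angle t) * piece_weight t).
  move=> Dt; apply: is_derive_eq (is_deriveZ _ (is_derive1_comp (is_derive_sin _)
    (is_deriveZ c (is_derive_piece_angle Dt)))) _.
  by rewrite /GRing.scale/=; field; rewrite c0 gt_eqF.
have csin (z : nat -> R) (l : R) : z m @[m --> \oo] --> l ->
    sin (c * z m) @[m --> \oo] --> sin (c * l).
  move=> zl; have cz : c * z m @[m --> \oo] --> c * l by apply: cvgMr.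
  by have := @continuous_cvg _ _ _ _ _ _ sin _ (@continuous_sin R (c * l)) cz; apply.
have cvgF : F (b_ m) - F (a_ m) @[m --> \oo]
    --> (- (c * 2 ^+ k.+1)^-1 * (sin (c * 0) - sin (c * (pi - 0))) : R).
  rewrite [X in X @ _ --> _](_ : _ = fun m =>
    - (c * 2 ^+ k.+1)^-1 * (sin (c * x_ m) - sin (c * (pi - x_ m)))); last first.
    apply/funext => m.
    have FE z : F z = - (c * 2 ^+ k.+1)^-1 * sin (c * piece_angle z) by [].
    by rewrite !FE piece_angle_b piece_angle_a -mulrBr.
  apply: cvgMr; apply: cvgB; apply: csin => //.
  by apply: cvgB => //; exact: cvg_cst.
have [intf ->] := improper_FTC a_lt_b nD DD fg cf cw dF dG cvgF cvgG.
by split => //; rewrite mulr0 sin0 subr0 sub0r mulrNN invfM; ring.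
Qed.

Lemma sin_natpi m : sin (m%:R * pi) = 0 :> R.
Proof.
elim: m => [|m IH]; first by rewrite mul0r sin0.
by rewrite -natr1 mulrDl mul1r sinDpi IH oppr0.
Qed.

(** The product is half the sum of the cosines of frequencies i + j and i - j. As sin vanishes at
    integer multiples of pi, only zero frequencies survive: both when i = j = 0, one when i = j >
    0. *)
Lemma integral_piece_weight_cosM (i j : nat) :
  mu.-integrable D (EFin \o (fun t =>
    cos (i%:R * piece_angle t) * cos (j%:R * piece_angle t) * piece_weight t)) /\
  \int[mu]_(t in D)
    (cos (i%:R * piece_angle t) * cos (j%:R * piece_angle t) * piece_weight t) =
  (if i == j then pi / (if i is 0 then 1 else 2) else 0) / 2 ^+ k.+1.
Proof.
have [intD ED] := integral_piece_weight_cos (i%:R + j%:R).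
have [intB EB] := integral_piece_weight_cos (i%:R - j%:R).
pose f (b : bool) (t : R) := if b
  then cos ((i%:R + j%:R) * piece_angle t) * piece_weight t
  else cos ((i%:R - j%:R) * piece_angle t) * piece_weight t.
have intf b : mu.-integrable D (EFin \o f b) by case: b.
have prodE t : cos (i%:R * piece_angle t) * cos (j%:R * piece_angle t) * piece_weight t =
    \sum_(b <- [:: true; false]) 2^-1 * f b t.
  by rewrite !big_cons big_nil /f mulrDl mulrBl cosB cosD; field.
have lin mD := Rintegral_lincomb [:: true; false] (fun=> 2^-1) mD intf.
have {lin} [intS SE] := lin (measurable_itv _).
rewrite (funext prodE); split; first exact: intS.
rewrite SE !big_cons big_nil addr0 /f ED EB.
rewrite subr_eq0 eqr_nat -natrD sin_natpi pnatr_eq0 addn_eq0.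
have sinB0 : sin ((i%:R - j%:R) * pi) = 0 :> R.
  by rewrite mulrBl sinB !sin_natpi mul0r mulr0 subr0.
rewrite sinB0 !mul0r; have [->|ij] := eqVneq i j.
  by case: j {f intf prodE intS SE intD ED intB EB sinB0} => [|j] /=;
    field; rewrite gt_eqF.
have /negbTE -> : ~~ ((i == 0) && (j == 0))%N.
  by apply: contra ij => /andP[/eqP -> /eqP ->].
by rewrite !mul0r mulr0 addr0.
Qed.

End ChebyshevWeight.

(** * The wavelets *)

Lemma poly_eq_itv (R : realType) (a b : R) (p q : {poly R}) : a < b ->
  (forall t, a < t < b -> p.[t] = q.[t]) -> p = q.
Proof.
move=> ab pq; apply/eqP; rewrite -subr_eq0; apply/negPn/negP => r0.
(* Distinct points strictly inside the interval, as many as the size of [p - q], hence more than its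
   degree. *)
pose x i : R := a + (b - a) / i.+2%:R.
have x_inj : injective x.
  move=> i j /addrI /mulfI; rewrite gt_eqF ?subr_gt0// => /(_ isT) /invr_inj.
  by move=> /eqP; rewrite eqr_nat => /eqP[].
have := @max_poly_roots _ (p - q) (map x (iota 0 (size (p - q)))) r0.
rewrite size_map size_iota ltnn (map_inj_uniq x_inj) iota_uniq => /(_ _ isT).
suff -> : all (root (p - q)) (map x (iota 0 (size (p - q)))) by move=> /(_ isT).
apply/allP => _ /mapP[i _ ->].
rewrite /root hornerD hornerN pq ?subrr//.
rewrite ltrDl divr_gt0 ?subr_gt0//= -ltrBrDl ltr_pdivrMr// ltr_pMr ?subr_gt0//.
by rewrite ltr1n.
Qed.

Lemma horner_norm_le (R : realType) (p : {poly R}) (t : R) : `|t| <= 1 ->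
  `|p.[t]| <= \sum_(i < size p) `|p`_i|.
Proof.
move=> t1; rewrite horner_coef; apply: le_trans (ler_norm_sum _ _ _) _.
by apply: ler_sum => i _; rewrite normrM normrX ler_piMr// exprn_ile1.
Qed.

Section Pieces.
Context {R : realType}.
Notation mu := (@lebesgue_measure R).
Variable k : nat.

Let D n : set R := `]n%:R / 2 ^+ k, n.+1%:R / 2 ^+ k[%classic.

Let pow_gt0 : 0 < 2 ^+ k :> R. Proof. by rewrite exprn_gt0. Qed.

Lemma open_piece_itv01 n : (n < 2 ^ k)%N -> D n `<=` `[0, 1].
Proof.
move=> nk t; rewrite /D/= !in_itv/= => /andP[nt tn]; apply/andP; split.
  by rewrite ltW// (le_lt_trans _ nt)// divr_ge0// ltW.
by rewrite ltW// (lt_le_trans tn)// ler_pdivrMr// mul1r -natrX ler_nat.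
Qed.

Lemma open_piece_sub n : D n `<=` dyadic k n.
Proof. exact: subset_itv_oo_cc. Qed.

Lemma open_piece_disjoint n n' t : n != n' -> D n t -> ~ dyadic k n' t.
Proof.
rewrite /D /dyadic/= !in_itv/= neq_ltn => nn' /andP[nt tn] /andP[nt' tn'].
case/orP: nn' => lt_n.
  have := le_lt_trans nt' tn.
  by rewrite ltr_pM2r ?invr_gt0// ltr_nat ltnS leqNgt lt_n.
have := lt_le_trans nt tn'.
by rewrite ltr_pM2r ?invr_gt0// ltr_nat ltnS leqNgt lt_n.
Qed.

(* At the endpoints of the piece the weight is 0^-1 = 0. *)
Lemma weightE n t : weight k n t = ((@piece_weight R k n) \_ (D n)) t.
Proof.
rewrite /weight /piece patchE.
have [/set_mem Dt|nDt] := boolP (t \in D n).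
  by rewrite mem_set//; exact: open_piece_sub.
case: ifPn => // /set_mem; rewrite /dyadic/= in_itv/= => /andP[nt tn].
have [tE|tE] : t = n%:R / 2 ^+ k \/ t = n.+1%:R / 2 ^+ k.
  move: nt tn; rewrite !le_eqVlt => /predU1P[->|nt]; first by left.
  move=> /predU1P[->|tn]; first by right.
  by move: nDt; rewrite mem_set// /D/= in_itv/= nt.
- have -> : 2 ^+ k.+1 * t - (2 * n)%:R - 1 = -1.
    by rewrite tE exprS natrM; field; rewrite gt_eqF.
  by rewrite sqrrN expr1n subrr sqrtr0 invr0.
- have -> : 2 ^+ k.+1 * t - (2 * n)%:R - 1 = 1.
    by rewrite tE exprS natrM -[n.+1%:R]natr1; field; rewrite gt_eqF.
  by rewrite expr1n subrr sqrtr0 invr0.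
Qed.

(** The weight vanishes off the open piece [n'], which misses every other closed piece; so for
    distinct pieces the integrand is zero everywhere, shared endpoints included. *)
Lemma inner_piece n n' (u v : R -> R) : (n' < 2 ^ k)%N ->
  inner (weight k n') (piece k n u) (piece k n' v) =
  if n == n' then \int[mu]_(t in D n') (u t * v t * piece_weight k n' t) else 0.
Proof.
move=> nk; rewrite /inner; case: eqVneq => [->|nn'].
  rewrite -[in RHS](setIidr (open_piece_itv01 nk)) Rintegral_mkcondr.
  apply: eq_Rintegral => t _; rewrite weightE !patchE.
  case: ifPn => [/set_mem Dt|_]; last by rewrite mulr0.
  by rewrite /piece mem_set//; exact: open_piece_sub.
rewrite (_ : (fun t => _) = cst 0); last first.
  apply/funext => t; rewrite weightE patchE.
  case: ifPn => [/set_mem Dt|_]; last by rewrite mulr0.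
  rewrite /piece memNset ?mul0r//; apply: open_piece_disjoint Dt.
  by rewrite eq_sym.
by rewrite /Rintegral /= integral0.
Qed.

(** A polynomial is bounded on [0, 1], and the weight is integrable by the frequency 0 case. *)
Lemma integrable_horner_piece_weight n (p : {poly R}) : (n < 2 ^ k)%N ->
  mu.-integrable (D n) (EFin \o (fun t => p.[t] * piece_weight k n t)).
Proof.
move=> nk; have [intw _] := @integral_piece_weight_cos R k n 0.
apply: le_integrable (integrableZl _ (\sum_(i < size p) `|p`_i|) intw) => //;
  try exact: measurable_itv.
- apply/measurable_EFinP; apply: open_continuous_measurable_fun.
    exact: interval_open.
  move=> t /set_mem Dt; apply: cvgM; first exact: continuous_horner.
  exact: continuous_piece_weight.
- move=> t Dt; rewrite /= mul0r cos0 mul1r lee_fin !normrM.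
  rewrite [X in _ <= X * _]ger0_norm ?sumr_ge0//.
  apply: ler_wpM2r => //; apply: horner_norm_le.
  have := open_piece_itv01 nk Dt; rewrite /= in_itv/= => /andP[t0 t1].
  by rewrite ger0_norm.
Qed.

Definition psi_poly (n m : nat) : {poly R} :=
  (cheb_beta m * 2 `^ (k%:R / 2)) *:
    (shifted_chebyshev_poly m \Po ((2 ^+ k : R) *: 'X - (n%:R)%:P)%R).

Lemma horner_psi_poly n m t : (psi_poly n m).[t] =
  cheb_beta m * 2 `^ (k%:R / 2) * shifted_chebyshev m (2 ^+ k * t - n%:R).
Proof.
rewrite hornerZ horner_comp horner_shifted_chebyshev.
by rewrite hornerD hornerN hornerZ hornerX hornerC.
Qed.

Lemma psiE n m : psi k n m = piece k n (horner (psi_poly n m)).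
Proof. by apply/funext => t; rewrite /psi /piece horner_psi_poly. Qed.

Lemma phiE n m : phi k n m = piece k n (horner ('X^m : {poly R})).
Proof. by apply/funext => t; rewrite /phi /piece hornerXn. Qed.

Lemma size_psi_poly n m : (size (psi_poly n m) <= m.+1)%N.
Proof.
apply: leq_trans (size_scale_leq _ _) _; apply: leq_trans (size_comp_poly_leq _ _) _.
rewrite ltnS; apply: leq_trans (_ : m * 1 <= m)%N; last by rewrite muln1.
apply: leq_mul.
  by have := @size_shifted_chebyshev_poly R m; case: (size _).
have : (size ((2 ^+ k : R) *: 'X - (n%:R)%:P)%R <= 2)%N.
  apply: leq_trans (size_polyD _ _) _; rewrite geq_max size_polyN.
  rewrite (leq_trans (size_scale_leq _ _)) ?size_polyX//.
  by rewrite (leq_trans (size_polyC_leq1 _)).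
by case: (size _) => [|[|[|]]].
Qed.

Lemma cheb_beta_sqr m : (cheb_beta m) ^+ 2 = (if m is 0 then 2 else 4) / pi :> R.
Proof.
have pi0 : 0 < pi :> R by exact: pi_gt0.
case: m => [|m] /=; first by rewrite sqr_sqrtr// divr_ge0 ?ltW.
by rewrite expr_div_n sqr_sqrtr ?ltW// -natrX.
Qed.

(** The constants balance: 2^k / 2^(k+1) = 1/2, against (2 / pi) pi = 2 for m = 0 and (4 / pi) (pi /
    2) = 2 for m > 0. *)
Lemma inner_psi n n' m m' : (n' < 2 ^ k)%N ->
  inner (weight k n') (psi k n m) (psi k n' m') = ((n == n') && (m == m'))%:R :> R.
Proof.
move=> nk; rewrite !psiE inner_piece//; case: eqVneq => //= ->.
have [intC CE] := @integral_piece_weight_cosM R k n' m m'.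
have pi0 : pi != 0 :> R by rewrite gt_eqF ?pi_gt0.
have k0 : 2 ^+ k != 0 :> R by rewrite gt_eqF.
have powk : 2 `^ (k%:R / 2) * 2 `^ (k%:R / 2) = 2 ^+ k :> R.
  by rewrite -powRD ?pnatr_eq0 ?implybT// -splitr powR_mulrn.
transitivity (cheb_beta m * cheb_beta m' * 2 ^+ k *
  \int[mu]_(t in D n') (cos (m%:R * piece_angle k n' t) *
    cos (m'%:R * piece_angle k n' t) * piece_weight k n' t) : R).
  rewrite -RintegralZl//; last exact: measurable_itv.
  apply: eq_Rintegral => t /set_mem Dt.
  by rewrite !horner_psi_poly !shifted_chebyshev_piece// -powk; ring.
rewrite CE; case: eqVneq => [->|_]; last by rewrite mul0r mulr0.
rewrite -expr2 cheb_beta_sqr exprS.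
move: pi0 {CE intC}; move: (@pi R) => c c0.
by case: m' => [|m'] /=; field; rewrite c0 k0.
Qed.

Lemma branchP n (f : R -> R) (p : {poly R}) :
  (forall t, D n t -> f t = p.[t]) -> branch k n f = p.
Proof.
move=> fp; apply: xget_subset1 => [t /= nt|p1 p2 /= fp1 fp2].
  by apply: fp; rewrite /D/= in_itv.
apply: (@poly_eq_itv _ (n%:R / 2 ^+ k) (n.+1%:R / 2 ^+ k)).
  by rewrite ltr_pM2r ?invr_gt0// ltr_nat.
by move=> t nt; rewrite -fp1// fp2.
Qed.

(** On every other piece [branch] is the zero polynomial, so the other summands vanish, even at an
    endpoint shared with piece [n]. *)
Lemma pw_caputo_piece q th n (p : {poly R}) t : (n < 2 ^ k)%N ->
  q%:R - 1 < th <= q%:R -> 0 < t ->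
  pw_caputo k q th (piece k n (horner p)) t =
  piece k n (caputo q th (horner p)) t.
Proof.
move=> nk thq t0; rewrite /pw_caputo (bigD1 (Ordinal nk))//= big1 ?addr0 => [|i ni].
  rewrite (@branchP _ _ p)// => s Ds.
  by rewrite /piece mem_set//; exact: open_piece_sub.
rewrite (@branchP _ _ 0) => [|s Ds].
  rewrite /piece caputo_horner// size_poly0 big_ord0.
  by case: ifP.
rewrite horner0 /piece memNset//.
by apply: open_piece_disjoint Ds; apply: contra ni => /eqP ni; apply/eqP/val_inj.
Qed.

End Pieces.

(** * Change of basis and the operational matrix *)

Section OperationalMatrix.
Context {R : realType}.
Variables k M : nat.
Notation mu := (@lebesgue_measure R).

(** The matrix B: coefficients in powers of t itself, not of the local variable 2^k t - n, to match
    the monomials [phi]. *)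
Definition psi_coef_mx : 'M[R]_(2 ^ k * M) := \matrix_(i, l)
  if idx_n i == idx_n l then (psi_poly k (idx_n i) (idx_m i))`_(idx_m l) else 0.

Lemma idx_n_lt (i : 'I_(2 ^ k * M)) : (idx_n i < 2 ^ k)%N.
Proof. exact: ltn_ord. Qed.

Lemma idx_inj (i j : 'I_(2 ^ k * M)) :
  (i == j) = (idx_n i == idx_n j) && (idx_m i == idx_m j).
Proof. by rewrite -(can_eq (@mxtens_unindexK _ _)) xpair_eqE. Qed.

Lemma size_psi_poly_idx (i : 'I_(2 ^ k * M)) :
  (size (@psi_poly R k (idx_n i) (idx_m i)) <= M)%N.
Proof. apply: leq_trans (size_psi_poly _ _ _) _; exact: ltn_ord. Qed.

(** Row i of B lives on the block of its own piece, so a sum over it is a sum over the coefficients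
    of one polynomial. It serves for values, inner products and derivatives alike. *)
Lemma psi_coef_mx_sum i (G : 'I_(2 ^ k * M) -> R) (H : nat -> R) :
  (forall l, idx_n l = idx_n i -> G l = H (idx_m l)) ->
  \sum_l psi_coef_mx i l * G l =
  \sum_(m < size (@psi_poly R k (idx_n i) (idx_m i)))
    (psi_poly k (idx_n i) (idx_m i))`_m * H m.
Proof.
move=> GH; set p := psi_poly _ _ _.
have -> : \sum_(m < size p) p`_m * H m = \sum_(m < M) p`_m * H m.
  rewrite (big_ord_widen_cond M xpredT (fun m => p`_m * H m))//; last first.
    exact: size_psi_poly_idx.
  rewrite [RHS](bigID (fun m : 'I_M => (m < size p)%N))/= [X in _ = _ + X]big1 ?addr0//.
  by move=> m; rewrite -leqNgt => pm; rewrite nth_default ?mul0r.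
rewrite (reindex (fun x : 'I_(2 ^ k) * 'I_M => mxtens_index x)) /=; last first.
  by exists (@mxtens_unindex _ _) => x _; [exact: mxtens_indexK|exact: mxtens_unindexK].
transitivity (\sum_(a < 2 ^ k) \sum_(b < M)
    psi_coef_mx i (mxtens_index (a, b)) * G (mxtens_index (a, b))).
  by rewrite pair_bigA; apply: eq_bigr => -[a b] _.
rewrite (bigD1 (mxtens_unindex i).1)//= [X in _ + X]big1 ?addr0.
  apply: eq_bigr => m _; rewrite mxE GH.
    by rewrite /idx_n /idx_m mxtens_indexK /= eqxx.
  by rewrite /idx_n mxtens_indexK.
move=> a ai; apply: big1 => b _; rewrite mxE /idx_n mxtens_indexK /=.
rewrite ifF ?mul0r//; apply/negbTE; apply: contra ai => /eqP aE.
by apply/eqP/val_inj/esym.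
Qed.

Lemma psi_idx_sum i t : psi_idx i t = \sum_l psi_coef_mx i l * phi_idx l t.
Proof.
rewrite (@psi_coef_mx_sum i _ (fun m => phi k (idx_n i) m t)); last first.
  by move=> l ln; rewrite /phi_idx ln.
rewrite /psi_idx psiE /piece; case: ifPn => tD.
  rewrite horner_coef; apply: eq_bigr => m _.
  by rewrite /phi /piece tD.
by rewrite big1// => m _; rewrite /phi /piece (negbTE tD) mulr0.
Qed.

Lemma Psi_coef t : Psi k M t = psi_coef_mx *m Phi k M t.
Proof.
apply/colP => i; rewrite !mxE psi_idx_sum.
by apply: eq_bigr => l _; rewrite [Phi _ _ _ _ _]mxE.
Qed.

Lemma mul_psi_coef_Pmx : psi_coef_mx *m Pmx k M = 1%:M.
Proof.
apply/matrixP => i j; rewrite !mxE.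
rewrite (@psi_coef_mx_sum i _ (fun m =>
  inner (weight k (idx_n j)) (phi k (idx_n i) m) (psi_idx j))); last first.
  by move=> l ln; rewrite mxE /phi_idx ln.
rewrite idx_inj -(@inner_psi R k _ _ _ _ (idx_n_lt j)) /psi_idx.
set p := psi_poly k (idx_n i) (idx_m i); pose pj := @psi_poly R k (idx_n j) (idx_m j).
have [nij|nij] := eqVneq (idx_n i) (idx_n j); last first.
  rewrite !psiE inner_piece ?idx_n_lt// (negbTE nij) big1// => m _.
  by rewrite phiE inner_piece ?idx_n_lt// (negbTE nij) mulr0.
rewrite !psiE inner_piece ?idx_n_lt// nij eqxx.
(* Integrability of each t^m psi_j against the weight allows the sum over m to pass under the
   integral, giving the inner product of psi_i and psi_j. *)
have intf (m : 'I_(size p)) := integrable_horner_piece_weight ('X^m * pj) (idx_n_lt j).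
have lin mD := Rintegral_lincomb (index_enum _) (fun m : 'I_(size p) => p`_m) mD intf.
transitivity (\int[mu]_(t in `](idx_n j)%:R / 2 ^+ k, (idx_n j).+1%:R / 2 ^+ k[)
  (\sum_(m < size p) p`_m * (('X^m * pj).[t] * piece_weight k (idx_n j) t))).
  rewrite (lin (measurable_itv _)).2; apply: eq_bigr => m _; congr (_ * _).
  rewrite phiE inner_piece ?idx_n_lt// eqxx.
  by apply: eq_Rintegral => t _; rewrite hornerM.
apply: eq_Rintegral => t _; rewrite -nij -/p horner_coef !mulr_suml.
by apply: eq_bigr => m _; rewrite hornerM hornerXn nij !mulrA.
Qed.

Lemma Pmx_unitmx : Pmx k M \in @unitmx R (2 ^ k * M).
Proof. by have [] := mulmx1_unit mul_psi_coef_Pmx. Qed.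

Lemma invmx_Pmx : invmx (Pmx k M) = psi_coef_mx.
Proof.
rewrite -[LHS]mul1mx -mul_psi_coef_Pmx -mulmxA mulmxV ?mulmx1//.
exact: Pmx_unitmx.
Qed.

Lemma Phi_Pmx t : @Phi R k M t = Pmx k M *m Psi k M t.
Proof. by rewrite Psi_coef mulmxA (mulmx1C mul_psi_coef_Pmx) mul1mx. Qed.

Lemma Tmx_diag q (th t : R) : Tmx k M q th t = diag_mx (\row_l
  if (q <= idx_m l)%N
  then t `^ (- th) * ((idx_m l)`!%:R / Gamma ((idx_m l)%:R - th + 1)) else 0).
Proof.
apply/matrixP => i j; rewrite !mxE idx_inj /idx_n /idx_m -!val_eqE /=.
by case: (_ %/ _ == _)%N; rewrite /= ?mul1r ?mul0r//.
Qed.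

(** The factor that [caputo_horner] attaches to a power depends on its exponent only, not on the
    piece, so it is exactly the diagonal entry of [Tmx]. *)
Lemma pw_caputo_Psi q th t : q%:R - 1 < th <= q%:R -> 0 < t ->
  pw_caputo_vec q th (Psi k M) t = psi_coef_mx *m Tmx k M q th t *m Phi k M t.
Proof.
move=> thq t0; apply/colP => i; rewrite -mulmxA Tmx_diag mul_diag_mx !mxE.
have -> : (fun s : R => Psi k M s i 0) =
    piece k (idx_n i) (horner (psi_poly k (idx_n i) (idx_m i))).
  by apply/funext => s; rewrite mxE /psi_idx psiE.
rewrite pw_caputo_piece ?idx_n_lt//.
rewrite (@psi_coef_mx_sum i _ (fun m =>
  (if (q <= m)%N then t `^ (- th) * (m`!%:R / Gamma (m%:R - th + 1)) else 0)
  * phi k (idx_n i) m t)); last first.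
  by move=> l ln; rewrite !mxE /phi_idx ln.
rewrite /piece /phi /piece caputo_horner//; case: ifP => _ //.
by rewrite big1// => m _; rewrite !mulr0.
Qed.

End OperationalMatrix.

Theorem theorem3p3 (R : realType) (k M q : nat) (theta : R -> R -> R)
  (theta_gt0 : forall x t : R, 0 <= x <= 1 -> 0 <= t <= 1 -> 0 < theta x t)
  (theta_q : forall x t : R, 0 <= x <= 1 -> 0 <= t <= 1 ->
     q%:R - 1 < theta x t <= q%:R) :
  [/\ Pmx k M \in @unitmx R (2 ^ k * M),
      forall t : R, 0 <= t <= 1 -> @Phi R k M t = Pmx k M *m Psi k M t
    & forall x t : R, 0 <= x <= 1 -> 0 < t <= 1 ->
        pw_caputo_vec q (theta x t) (@Psi R k M) t
          = (invmx (Pmx k M) *m Tmx k M q (theta x t) t *m Pmx k M) *m Psi k M t].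
Proof.
split; [exact: Pmx_unitmx|by move=> t _; exact: Phi_Pmx|].
move=> x t x01 /andP[t0 t1].
rewrite -[RHS]mulmxA -Phi_Pmx invmx_Pmx; apply: pw_caputo_Psi => //.
by apply: theta_q => //; rewrite ltW.
Qed.
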